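(* Let $(M,g)$ be a connected spacelike Jordan Ivanov-Petrova pseudo-Riemannian manifold of signature $(p,q)$. Assume either that $(p,q)=(0,4)$ or that $q\ge 5$. Assume that $\mathcal{R}(\pi)$ is not nilpotent for at least one oriented spacelike $2$-plane $\pi$ in $TM$ (that is, $\pi\subset T_PM$ for some $P\in M$), and that for every $P\in M$ the model space $\mathcal{T}_P=(T_PM,g_P,R_P)$ has constant spacelike rank $2$. Then: (1) $(M,g)$ is $k$-spacelike Jordan Stanilov for any $2\le k\le q$. (2) $(M,g)$ is $k$-timelike Jordan Stanilov for any $2\le k\le p$.
   Context: Signature $(p,q)$ means $p$ timelike (negative) and $q$ spacelike (positive) directions. A model space is a triple $\mathcal{V}=(V,g,R)$ where $V$ is a finite dimensional real vector space, $g$ is a non-degenerate inner product on $V$ of signature $(p,q)$, and $R\in\otimes^4V^*$ is an algebraic curvature tensor: $R(x,y,z,w)=R(z,w,x,y)=-R(y,x,z,w)$ and $R(x,y,z,w)+R(y,z,x,w)+R(z,x,y,w)=0$. The curvature operator $R(x,y)$ is the linear map of $V$ determined by $R(x,y,z,w)=g(R(x,y)z,w)$. A linear subspace is spacelike (resp. timelike) if the restriction of $g$ to it is positive (resp. negative) definite. For an oriented spacelike or timelike $2$-plane $\pi$ with oriented orthonormal basis $\{e_1,e_2\}$, the skew-symmetric curvature operator is $\mathcal{R}(\pi):=R(e_1,e_2)$ (independent of the basis). $\mathcal{V}$ has constant spacelike rank $r$ if $\operatorname{Rank}\{\mathcal{R}(\pi)\}=r$ for every oriented spacelike $2$-plane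 $\pi$. $\mathcal{V}$ is spacelike (resp. timelike) Jordan Ivanov-Petrova if the Jordan normal form (conjugacy class) of $\mathcal{R}(\pi)$ is the same for all oriented spacelike (resp. timelike) $2$-planes $\pi$. For an unoriented spacelike or timelike $k$-plane $\pi$ with orthonormal basis $\{e_1,\dots,e_k\}$, the higher order curvature operator is $\Theta(\pi):=\sum_{i,j}R(e_i,e_j)R(e_i,e_j)$ (independent of the basis). $\mathcal{V}$ is $k$-spacelike (resp. $k$-timelike) Jordan Stanilov if the Jordan normal form of $\Theta(\pi)$ is the same for all spacelike (resp. timelike) $k$-planes $\pi$. A pseudo-Riemannian manifold $(M,g)$ with Riemann curvature tensor $R$ of the Levi-Civita connection is said to have one of these Jordan Ivanov-Petrova or Jordan Stanilov properties if the model space $\mathcal{T}_P=(T_PM,g_P,R_P)$ has it for every $P\in M$; the Jordan normal form is allowed to vary with $P$. *)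

(* Defs.v *)
From mathcomp Require Import all_boot all_order all_algebra.
From mathcomp Require Import all_classical all_reals all_analysis.
Import Order.TTheory GRing.Theory Num.Theory numFieldNormedType.Exports.

Set Implicit Arguments.
Unset Strict Implicit.
Unset Printing Implicit Defensive.

Local Open Scope classical_set_scope.
Local Open Scope ring_scope.

(** Model spaces, written in a basis: [V = 'rV[R]_n], the inner product is
    given by its Gram matrix.  Only the data are recorded; signature is part of
    the definition of a metric below, and the algebraic symmetries of [curv]
    are automatic for the curvature of a metric. *)

Record model_space (R : realType) (n : nat) := ModelSpace {
  gram_mx : 'M[R]_n;
  curv : 'rV[R]_n -> 'rV[R]_n -> 'rV[R]_n -> 'rV[R]_n -> R
}.

Section ModelSpace.
Variables (R : realType) (n : nat) (V : model_space R n).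
Implicit Types (x y z w : 'rV[R]_n) (W : {vspace 'rV[R]_n}) (A B : 'M[R]_n).

Definition ip x y : R := (x *m gram_mx V *m y^T) 0 0.

Definition spacelike W := forall x, x \in W -> x != 0 -> 0 < ip x x.
Definition timelike W := forall x, x \in W -> x != 0 -> ip x x < 0.

(* Allows both signs; on a spacelike (timelike) W, ip (e_i) (e_i) = 1 (-1). *)
Definition orthonormal_basis k W (e : k.-tuple 'rV[R]_n) :=
  [/\ basis_of W e,
      forall i, `|ip (tnth e i) (tnth e i)| = 1
    & forall i j, i != j -> ip (tnth e i) (tnth e j) = 0].

(* Endomorphisms are matrices acting on row vectors, z |-> z *m A.  For
   invertible gram_mx and curv linear in its last two arguments, this is the
   unique A with  curv x y z w = ip (z *m A) w  for all z, w. *)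
Definition curv_op x y : 'M[R]_n :=
  (\matrix_(k, l) curv V x y (delta_mx 0 k) (delta_mx 0 l)) *m invmx (gram_mx V).

(* The orientation of the 2-plane is the one given by the ordered basis e. *)
Definition skew_curv_op (e : 2.-tuple 'rV[R]_n) : 'M[R]_n :=
  curv_op (tnth e ord0) (tnth e ord_max).

Definition higher_curv_op k (e : k.-tuple 'rV[R]_n) : 'M[R]_n :=
  \sum_(i < k) \sum_(j < k)
    curv_op (tnth e i) (tnth e j) *m curv_op (tnth e i) (tnth e j).

(* Same Jordan normal form, i.e. same conjugacy class. *)
Definition jordan_equivalent A B :=
  exists2 P : 'M[R]_n, P \in unitmx & conjmx P A = B.

Definition nilpotent_mx A := exists m : nat, A ^+ m = 0.

Definition constant_spacelike_rank (r : nat) :=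
  forall W (e : 2.-tuple 'rV[R]_n), spacelike W -> orthonormal_basis W e ->
    \rank (skew_curv_op e) = r.

Definition jordan_IP (causal : {vspace 'rV[R]_n} -> Prop) :=
  forall W1 W2 (e1 e2 : 2.-tuple 'rV[R]_n),
    causal W1 -> causal W2 ->
    orthonormal_basis W1 e1 -> orthonormal_basis W2 e2 ->
    jordan_equivalent (skew_curv_op e1) (skew_curv_op e2).

Definition jordan_stanilov (causal : {vspace 'rV[R]_n} -> Prop) (k : nat) :=
  forall W1 W2 (e1 e2 : k.-tuple 'rV[R]_n),
    causal W1 -> causal W2 ->
    orthonormal_basis W1 e1 -> orthonormal_basis W2 e2 ->
    jordan_equivalent (higher_curv_op e1) (higher_curv_op e2).

Definition spacelike_jordan_IP := jordan_IP spacelike.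
Definition spacelike_jordan_stanilov := jordan_stanilov spacelike.
Definition timelike_jordan_stanilov := jordan_stanilov timelike.

End ModelSpace.

Section Smooth.
Variables (R : realType) (n : nat).

Definition pderiv (i : 'I_n) (f : 'rV[R]_n -> R) : 'rV[R]_n -> R :=
  fun x => 'D_(delta_mx 0 i) f x.

(* C^oo on U (used for open U only): every iterated partial derivative is
   differentiable at every point of U. *)
Definition smooth_on (U : set 'rV[R]_n) (f : 'rV[R]_n -> R) :=
  forall (s : seq 'I_n) x, U x -> differentiable (foldr pderiv f s) x.

End Smooth.

(* A homeomorphism from an open set of M onto an open set of R^n.  The values
   of coord and coord_inv outside these sets are irrelevant. *)
Record chart (R : realType) (M : topologicalType) (n : nat) := Chart {
  dom : set M;
  coord : M -> 'rV[R]_n;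
  coord_inv : 'rV[R]_n -> M;
  dom_open : open dom;
  codom_open : open (coord @` dom);
  coordK : forall P, dom P -> coord_inv (coord P) = P;
  coord_cont : forall P, dom P -> {for P, continuous coord};
  coord_inv_cont :
    forall P, dom P -> {for coord P, continuous coord_inv}
}.

Definition transition (R : realType) (M : topologicalType) (n : nat)
    (c d : chart R M n) : 'rV[R]_n -> 'rV[R]_n :=
  coord d \o coord_inv c.

Record smooth_manifold (R : realType) (n : nat) := SmoothManifold {
  space :> topologicalType;
  atlas : set (chart R space n);
  space_hausdorff : hausdorff_space space;
  space_second_countable : @second_countable space;
  atlas_cover : forall P : space, exists2 c, atlas c & dom c P;
  atlas_smooth : forall c d, atlas c -> atlas d -> forall i : 'I_n,
    smooth_on (coord c @` (dom c `&` dom d)) (fun x => transition c d x 0 i)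
}.

(* Existence of an orthonormal basis (the rows of B) of p timelike and q
   spacelike vectors; G is then symmetric and invertible. *)
Definition has_signature (R : realType) (p q : nat) (G : 'M[R]_(p + q)) :=
  exists2 B : 'M[R]_(p + q), B \in unitmx &
    B *m G *m B^T = block_mx (- 1%:M) 0 0 1%:M.

(* metric c x is the matrix of the g(d_i, d_j) in the chart c at the point with
   coordinates x.  The library's Jacobian acts on row vectors, so its entry
   (i, j) is the i-th partial derivative of the j-th component. *)
Record pseudo_riemannian_metric (R : realType) (p q : nat)
    (M : smooth_manifold R (p + q)) := PseudoRiemannianMetric {
  metric :> chart R M (p + q) -> 'rV[R]_(p + q) -> 'M[R]_(p + q);
  metric_smooth : forall c, atlas c -> forall i j : 'I_(p + q),
    smooth_on (coord c @` dom c) (fun x => metric c x i j);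
  metric_signature : forall c, atlas c -> forall P, dom c P ->
    has_signature (metric c (coord c P));
  metric_compat : forall c d, atlas c -> atlas d ->
    forall P, dom c P -> dom d P ->
    let J := jacobian (transition c d) (coord c P) in
    metric c (coord c P) = J *m metric d (coord d P) *m J^T
}.

Section Curvature.
Variables (R : realType) (n : nat) (G : 'rV[R]_n -> 'M[R]_n).
Implicit Types (i j k l m s : 'I_n) (x : 'rV[R]_n).

(* Gamma^l_{jk} of the Levi-Civita connection of G. *)
Definition christoffel l j k x : R :=
  2^-1 * \sum_s invmx (G x) l s *
    (pderiv j (fun y => G y k s) x + pderiv k (fun y => G y j s) x
     - pderiv s (fun y => G y j k) x).

(* The d_l component of R(d_i, d_j) d_k, where
   R(X, Y) Z = nabla_X nabla_Y Z - nabla_Y nabla_X Z - nabla_[X,Y] Z. *)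
Definition riemann_up i j k l x : R :=
  pderiv i (christoffel l j k) x - pderiv j (christoffel l i k) x
  + \sum_m (christoffel l i m x * christoffel m j k x
            - christoffel l j m x * christoffel m i k x).

Definition riemann i j k l x : R := \sum_s riemann_up i j k s x * G x s l.

End Curvature.

(* The model space (T_P M, g_P, R_P), with T_P M identified with R^(p + q) by
   the coordinate basis of the chart c at P. *)
Definition tangent_model (R : realType) (p q : nat)
    (M : smooth_manifold R (p + q)) (g : pseudo_riemannian_metric M)
    (c : chart R M (p + q)) (P : M) : model_space R (p + q) :=
  ModelSpace (g c (coord c P))
    (fun x y z w => \sum_i \sum_j \sum_k \sum_l
       x 0 i * y 0 j * z 0 k * w 0 l * riemann (g c) i j k l (coord c P)).

(* Tangent models of P in different charts are isomorphic, so it is immaterial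
   which charts of the atlas around P are used. *)
Definition at_every_point (R : realType) (p q : nat)
    (M : smooth_manifold R (p + q)) (g : pseudo_riemannian_metric M)
    (prop : model_space R (p + q) -> Prop) :=
  forall (P : M) c, atlas c -> dom c P -> prop (tangent_model g c P).

Definition at_some_point (R : realType) (p q : nat)
    (M : smooth_manifold R (p + q)) (g : pseudo_riemannian_metric M)
    (prop : model_space R (p + q) -> Prop) :=
  exists (P : M) c, [/\ atlas c, dom c P & prop (tangent_model g c P)].

(* Main.v *)
Require Import Defs.
From mathcomp Require Import all_boot all_order all_algebra.
From mathcomp Require Import all_classical all_reals all_analysis.
From mathcomp Require Import ring lra.
Import Order.TTheory GRing.Theory Num.Theory numFieldNormedType.Exports.

Set Implicit Arguments.
Unset Strict Implicit.
Unset Printing Implicit Defensive.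

Local Open Scope classical_set_scope.
Local Open Scope ring_scope.

(** At each point the rank condition makes every R(x, y) with x, y spanning a
    spacelike plane a decomposable 2-form, and by Zariski density this holds
    for all x, y.  Polarizing R(x, y) /\ R(x, y) = 0 and contracting with x
    relates R(x, .) to the Jacobi form J_x(y, z) = R(x, y, x, z); with the
    Bianchi identity this forces a Gauss equation
      R(y, z, a, b) = c (h(y, a) h(z, b) - h(y, b) h(z, a)),  c <> 0,
    for a symmetric form h.  Put phi = h composed with the inverse of g.  The
    trace of R(pi)^2 is, up to a constant, the Gram determinant of
    L(y, z) = g(phi y, phi z) on pi; it is constant by the Jordan condition,
    so L = lambda g (if the determinant vanishes, a null plane of L makes all
    R(pi)^2 vanish, and then L = 0).  If g is eps = 1 or -1 on an orthonormal
    basis of the k-plane pi, then Theta(pi) = 2 (1 - k) c^2 mu Q with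
    mu = eps lambda, where for mu <> 0 the map Q has rank k and Q^2 = mu Q;
    such maps are all conjugate.  The argument is pointwise. *)

(** * Algebraic curvature tensors with decomposable values *)

Section SymmetricForms.
Variables (R : realFieldType) (V : lmodType R).

Definition symm_bilinear (J : V -> V -> R) :=
  (forall a x y z, J (a *: x + y) z = a * J x z + J y z) /\
  (forall x y, J x y = J y x).

Lemma symm_bilinearDl J x y z : symm_bilinear J -> J (x + y) z = J x z + J y z.
Proof. by case=> /(_ 1 x y z) + _; rewrite scale1r mul1r. Qed.

Lemma symm_bilinearDr J x y z : symm_bilinear J -> J x (y + z) = J x y + J x z.
Proof. by move=> sJ; rewrite !(sJ.2 x) (symm_bilinearDl _ _ _ sJ). Qed.

Lemma symm_bilinearPr J t x y z : symm_bilinear J ->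
  J x (t *: y + z) = t * J x y + J x z.
Proof. by move=> [JP JC]; rewrite JC JP !(JC x). Qed.

Lemma symm_bilinear_eq0 J : symm_bilinear J ->
  (forall w, J w w = 0) -> forall y z, J y z = 0.
Proof.
move=> sJ J0 y z; have := J0 (y + z).
rewrite (symm_bilinearDl _ _ _ sJ) !(symm_bilinearDr _ _ _ sJ) !J0.
rewrite (sJ.2 z y); lra.
Qed.

(** For each [y] the covectors [J y] and [K y] are parallel. At [w] the factor is [K w w / J w w];
    polarizing at [y + w] shows that it is the same for every [y]. *)
Lemma parallel_forms J K w : symm_bilinear J -> symm_bilinear K ->
  (forall y a b, J y a * K y b = J y b * K y a) -> J w w != 0 ->
  forall y z, K y z = K w w / J w w * J y z.
Proof.
move=> sJ sK par Jw; set c := K w w / J w w.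
have cE : K w w = c * J w w by rewrite /c divfK.
have Kw b : K w b = c * J w b.
  apply: (mulfI Jw); have := par w w b; rewrite cE; lra.
move=> y z; have Kyw : K y w = c * J y w by rewrite sK.2 Kw sJ.2.
apply: (mulfI Jw); have := par (y + w) w z; have := par y w z.
rewrite !(symm_bilinearDl _ _ _ sJ) !(symm_bilinearDl _ _ _ sK) cE Kw Kyw; lra.
Qed.

(* T y is a family of 2-forms and [wedge0] says J_y /\ T_z + J_z /\ T_y = 0,
   where J_y = J y _; the conclusion is T_y = u /\ J_y for a covector u. *)
Section TwoFormFamily.
Variables (J : V -> V -> R) (T : V -> V -> V -> R) (w : V).
Hypothesis sJ : symm_bilinear J.
Hypothesis wedge0 : forall y z b c d,
  J y b * T z c d - J y c * T z b d + J y d * T z b c +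
  (J z b * T y c d - J z c * T y b d + J z d * T y b c) = 0.

(** For alternating [T w], [K y] is the contraction with [w] of the 2-form in parentheses in
    [two_form_family_normal]. [J'] is [J] with its [w]-component removed, scaled by [J w w]. *)
Let K y b := J w w * T y w b - T w w b * J y w.
Let J' y z := J w w * J y z - J w y * J w z.

(** Contract [wedge0] for the pair [w, y] with [w], then eliminate [T w a b] by the same relation
    for the pair [w, w]. *)
Lemma two_form_family_normal y a b :
  J w w * (J w w * T y a b + T w w a * J y b - T w w b * J y a) =
  J w a * K y b - J w b * K y a.
Proof.
have JC := sJ.2.
have := congr1 ( *%R (J w w)) (wedge0 w y w a b).
have := congr1 ( *%R (J y w)) (wedge0 w w w a b).
rewrite /K (JC y w) mulr0; lra.
Qed.

Lemma two_form_family_parallel y a b :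
  J' y a * K y b = J' y b * K y a.
Proof.
have JC := sJ.2.
have := congr1 ( *%R (J w y)) (two_form_family_normal y a b).
have := congr1 ( *%R (J w w * J w w)) (wedge0 y y w a b).
rewrite /J' /K (JC y w) mulr0; lra.
Qed.

Hypothesis TP1 : forall t x y a b, T (t *: x + y) a b = t * T x a b + T y a b.
Hypothesis TP3 : forall t a b x y, T a b (t *: x + y) = t * T a b x + T a b y.
Hypothesis bianchiT : forall y a b, T y a b + T a b y + T b y a = 0.
Hypothesis TN : forall y a b, T y a b = - T y b a.
Hypothesis Jw : J w w != 0.

(** Since [K w] vanishes, the normal form expresses [T w] through [T w w] and [J w]; the Bianchi
    identity for [y, w, b] then becomes the symmetry of [K]. *)
Let K_sym y b : K y b = K b y.
Proof.
have JC := sJ.2.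
have := two_form_family_normal w b y.
have -> : K w y = 0 by rewrite /K; ring.
have -> : K w b = 0 by rewrite /K; ring.
rewrite !mulr0 subr0 => /eqP; rewrite mulf_eq0 (negPf Jw) => /eqP.
have := congr1 ( *%R (J w w)) (bianchiT y w b).
rewrite /K (TN b y w) (JC y w) (JC b w) mulr0; lra.
Qed.

(** The condition on [w1] says that [J] has rank at least 2, so [J'] is nonzero and [parallel_forms]
    makes [K] a multiple of [J']. *)
Lemma two_form_family_factor w1 : J w w * J w1 w1 != J w w1 * J w w1 ->
  exists2 u : V -> R, forall t x y, u (t *: x + y) = t * u x + u y &
    forall y a b, T y a b = u a * J y b - u b * J y a.
Proof.
move=> w1P; have [JP JC] := sJ.
have sJ' : symm_bilinear J'.
  split=> [t x y z|x y]; last by rewrite /J' JC; lra.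
  by rewrite /J' !(JC w) !JP; lra.
have sK : symm_bilinear K.
  by split=> [t x y z|//]; rewrite /K TP1 JP; lra.
have J'w1 : J' w1 w1 != 0 by rewrite /J' subr_eq0.
have KE := parallel_forms sJ' sK two_form_family_parallel J'w1.
set k := K w1 w1 / J' w1 w1 in KE.
(* With [K = k J'] the normal form reads [J w w * T y] = ([k J w - T w w]) wedge [J y]. *)
exists (fun a => (k * J w a - T w w a) / J w w) => [t x y|y a b].
  by rewrite !(JC w) JP TP3; ring.
have := two_form_family_normal y a b; rewrite !KE /J' => e.
have {}e : J w w * (J w w * T y a b) =
  J w w * ((k * J w a - T w w a) * J y b - (k * J w b - T w w b) * J y a).
  by move: e; lra.
by apply: (mulfI Jw); rewrite (mulfI Jw e); field.
Qed.

(** On the kernel of [J w] the form [T _ w _] is symmetric by [K_sym] and skew by hypothesis, hence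
    zero. Subtracting the [w]-component of [b] extends [T c w b = 0] to all [b], and the normal form
    then kills [T c]. *)
Lemma two_form_family_rank1 :
  (forall y z, J w w * J y z = J w y * J w z) ->
  (forall c e y, J w c = 0 -> J w e = 0 -> T c y e + T e y c = 0) ->
  forall c, J w c = 0 -> forall a b, T c a b = 0.
Proof.
move=> rk1 skew c cw; have [JP JC] := sJ.
have Jc y : J c y = 0 by apply: (mulfI Jw); rewrite rk1 cw; lra.
have Tcw e : J w e = 0 -> T c w e = 0.
  move=> ew; have := K_sym c e; rewrite /K !(JC _ w) cw ew !mulr0 !subr0.
  by move=> /(mulfI Jw); have := skew c e w cw ew; lra.
have {}Tcw b : T c w b = 0.
  have Tcww : T c w w = 0 by have := TN c w w; lra.
  have := Tcw (- (J w b / J w w) *: w + b); rewrite TP3 Tcww mulr0 add0r.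
  by apply; rewrite JC JP (JC b); field.
move=> a b; have := two_form_family_normal c a b.
rewrite /K !Tcw !Jc !mulr0 !subr0 addr0 => e.
by apply: (mulfI Jw); apply: (mulfI Jw); move: e; lra.
Qed.

End TwoFormFamily.

End SymmetricForms.

(** * Curvature tensors and their Jacobi forms *)

Section CurvatureTensors.
Variables (R : realFieldType) (V : lmodType R).

Record curvature_tensor (F : V -> V -> V -> V -> R) : Prop := CurvatureTensor {
  curvP : forall t x y z a b, F (t *: x + y) z a b = t * F x z a b + F y z a b;
  curvN : forall x y a b, F x y a b = - F y x a b;
  curvC : forall x y a b, F x y a b = F a b x y;
  curv_bianchi : forall x y z w, F x y z w + F y z x w + F z x y w = 0 }.

Variable F : V -> V -> V -> V -> R.
Hypothesis cF : curvature_tensor F.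

Lemma curvNr x y a b : F x y a b = - F x y b a.
Proof. by rewrite (curvC cF) (curvN cF) (curvC cF). Qed.

Lemma curvD1 x y z a b : F (x + y) z a b = F x z a b + F y z a b.
Proof. by have := curvP cF 1 x y z a b; rewrite scale1r mul1r. Qed.

Lemma curvP2 t x y z a b : F z (t *: x + y) a b = t * F z x a b + F z y a b.
Proof. rewrite (curvN cF) (curvP cF) !(curvN cF _ z); lra. Qed.

Lemma curvD2 x y z a b : F z (x + y) a b = F z x a b + F z y a b.
Proof. by have := curvP2 1 x y z a b; rewrite scale1r mul1r. Qed.

Lemma curvP3 t x y z a b : F a b (t *: x + y) z = t * F a b x z + F a b y z.
Proof. by rewrite !(curvC cF a b) (curvP cF). Qed.

Lemma curvP4 t x y z a b : F a b z (t *: x + y) = t * F a b z x + F a b z y.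
Proof. by rewrite !(curvC cF a b) curvP2. Qed.

Lemma curv_diag x a b : F x x a b = 0.
Proof. by have := curvN cF x x a b; lra. Qed.

Lemma curv_diagr x a b : F a b x x = 0.
Proof. by rewrite (curvC cF) curv_diag. Qed.

Lemma curv_shear s t r y z a b :
  F (s *: y) (r *: y + t *: z) a b = s * t * F y z a b.
Proof.
have F0 w : F w 0 a b = 0.
  by have := curvP2 1 0 0 w a b; rewrite scale1r addr0; lra.
have FZ w v k : F w (k *: v) a b = k * F w v a b.
  by have := curvP2 k v 0 w a b; rewrite F0 !addr0.
by rewrite curvP2 FZ !(curvN cF (s *: y)) !FZ curv_diag (curvN cF z); ring.
Qed.

Lemma jacobi_form x : symm_bilinear (fun y z => F x y x z).
Proof.
split=> [t y z a|y z]; first exact: curvP2.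
exact: (curvC cF).
Qed.

Lemma curv_bianchir x y z w : F x y z w + F x z w y + F x w y z = 0.
Proof.
have := curv_bianchi cF y z w x.
rewrite !(curvNr _ _ _ x) !(curvC cF _ _ x); lra.
Qed.

Hypothesis decF : forall x y a b c d,
  F x y a b * F x y c d - F x y a c * F x y b d + F x y a d * F x y b c = 0.

(** Polarization of [decF] in its second argument. It is [wedge0] for the Jacobi form of [x] and the
    family [F x]. *)
Lemma jacobi_decomp x y z b c d :
  F x y x b * F x z c d - F x y x c * F x z b d + F x y x d * F x z b c +
  (F x z x b * F x y c d - F x z x c * F x y b d + F x z x d * F x y b c) = 0.
Proof.
have := decF x (y + z) x b c d; rewrite !curvD2.
have := decF x y x b c d; have := decF x z x b c d; lra.
Qed.

(** The skewness required by [two_form_family_rank1] is the first variation of the rank one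
    condition when [x] moves to [x + t *: y]: on the right both factors vanish at [t = 0], so the
    derivative of the Jacobi form at [c, e] must vanish too. *)
Lemma jacobi_rank1 x w :
  (forall y a b c e, F y a y b * F y c y e = F y a y e * F y c y b) ->
  F x w x w != 0 -> forall c, F x c x w = 0 -> forall a b, F x c a b = 0.
Proof.
move=> rk1 Jw c cw a b.
apply: (@two_form_family_rank1 _ _ (fun y z => F x y x z) (F x) w) => //.
- exact: jacobi_form.
- exact: jacobi_decomp.
- by move=> t d e y z; rewrite curvP4.
- exact: curv_bianchir.
- exact: curvNr.
- by move=> y z; rewrite rk1 (curvC cF x y); ring.
- move=> {cw}c e y cw ew.
  have poly t : F (x + t *: y) w (x + t *: y) w *
     F (x + t *: y) c (x + t *: y) e =
     F (x + t *: y) w (x + t *: y) e * F (x + t *: y) c (x + t *: y) w.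
    exact: rk1.
  have ce : F x c x e = 0.
    by apply: (mulfI Jw); rewrite rk1 ew; ring.
  (* Both sides are quartic in t; these four values isolate the coefficient of
     t, which is the claim. *)
  move: (poly 1) (poly (-1)) (poly 2) (poly (-2)).
  rewrite !(addrC x) !(curvP cF) !curvP3.
  rewrite (curvC cF x c x w) !cw !ew !ce.
  move=> e1 e2 e3 e4; apply: (mulfI Jw).
  have -> : F x e y c = F y c x e by rewrite (curvC cF).
  by move: e1 e2 e3 e4; lra.
- by rewrite (curvC cF).
Qed.

(** The normalization [u x = 1] follows by evaluating the factorization at [w, x, w]. *)
Lemma jacobi_factor x w w1 : F x w x w != 0 ->
  F x w x w * F x w1 x w1 != F x w x w1 * F x w x w1 ->
  exists2 u : V -> R, forall t x y, u (t *: x + y) = t * u x + u y &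
    u x = 1 /\ forall y a b, F x y a b = u a * F x y x b - u b * F x y x a.
Proof.
move=> Jw w1P.
have [] := @two_form_family_factor _ _ (fun y z => F x y x z) (F x) w _ _ _ _ _
  _ Jw w1 w1P.
- exact: jacobi_form.
- exact: jacobi_decomp.
- by move=> t y z a b; rewrite curvP2.
- by move=> t d e y z; rewrite curvP4.
- exact: curv_bianchir.
- exact: curvNr.
move=> u uP uE; exists u => //; split=> //.
by apply: (mulIf Jw); have := uE w x w; rewrite curv_diagr; lra.
Qed.

End CurvatureTensors.

(** * Kulkarni-Nomizu products and the Gauss equation *)

Section KulkarniNomizu.
Variables (R : realFieldType) (V : lmodType R).
Implicit Types (h k J : V -> V -> R) (F G : V -> V -> V -> V -> R).

Definition kulkarni_nomizu h k (y z a b : V) :=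
  h y a * k z b + k y a * h z b - h y b * k z a - k y b * h z a.

Lemma kulkarni_nomizu_curvature h k : symm_bilinear h -> symm_bilinear k ->
  curvature_tensor (kulkarni_nomizu h k).
Proof.
move=> [hP hC] [kP kC]; rewrite /kulkarni_nomizu; split.
- by move=> t x y z a b; rewrite !hP !kP; ring.
- by move=> x y a b; ring.
- by move=> x y a b; rewrite !(hC a) !(hC b) !(kC a) !(kC b); ring.
- move=> x y z w.
  by rewrite (hC y x) (hC z x) (hC z y) (kC y x) (kC z x) (kC z y); ring.
Qed.

Lemma curvature_tensorB F G : curvature_tensor F -> curvature_tensor G ->
  curvature_tensor (fun x y a b => F x y a b - G x y a b).
Proof.
move=> cF cG; split.
- by move=> t x y z a b; rewrite (curvP cF) (curvP cG); ring.
- by move=> x y a b; rewrite (curvN cF) (curvN cG); ring.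
- by move=> x y a b; rewrite (curvC cF) (curvC cG).
- by move=> x y z w; have := curv_bianchi cF x y z w;
    have := curv_bianchi cG x y z w; lra.
Qed.

(** Polarizing the hypothesis at [w + y] and contracting with [w] expresses [F w z] through [J w]
    and the Jacobi form [K] of [w]. The hypothesis makes [K] parallel to [J'], which determines
    [F w z] up to a constant [c]; the polarized relation carries this over to [F y z]. *)
Lemma curvature_wedge_form F J w w1 : curvature_tensor F -> symm_bilinear J ->
  (forall y z b c d, J y b * F z y c d - J y c * F z y b d +
     J y d * F z y b c = 0) ->
  J w w != 0 -> J w w * J w1 w1 != J w w1 * J w w1 ->
  exists c, forall y z a b, F y z a b = c * (J y a * J z b - J y b * J z a).
Proof.
move=> cF sJ wedge0 Jw w1P; have [JP JC] := sJ.
have wedge y b c d z : J y b * F w z c d - J y c * F w z b d + J y d * F w z b c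
    + (J w b * F y z c d - J w c * F y z b d + J w d * F y z b c) = 0.
  have := wedge0 (w + y) z b c d; have := wedge0 w z b c d.
  have := wedge0 y z b c d; rewrite !(symm_bilinearDl _ _ _ sJ) !(curvD2 cF).
  rewrite !(curvN cF z); lra.
pose J' y z := J w w * J y z - J w y * J w z.
pose K z b := F w z w b.
have sJ' : symm_bilinear J'.
  split=> [t x y z|x y]; last by rewrite /J' JC; lra.
  by rewrite /J' !(JC w) !JP; ring.
have sK : symm_bilinear K := jacobi_form cF w.
have FwE z a b : J w w * F w z a b = J w a * K z b - J w b * K z a.
  by have := wedge w w a b z; rewrite /K; lra.
have par y a b : J' y a * K y b = J' y b * K y a.
  have := congr1 ( *%R (J w y)) (FwE y a b).
  have := congr1 ( *%R (J w w)) (wedge y w a b y).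
  by rewrite /J' /K !curv_diag// (JC y w) !mulr0; lra.
have J'w1 : J' w1 w1 != 0 by rewrite /J' subr_eq0.
have KE := parallel_forms sJ' sK par J'w1.
set c := K w1 w1 / J' w1 w1 in KE; exists c => y z a b.
have {}FwE s p q : F w s p q = c * (J w p * J s q - J w q * J s p).
  by apply: (mulfI Jw); rewrite FwE !KE /J'; ring.
apply: (mulfI Jw); have := wedge y w a b z.
rewrite !(curvC cF y z w) !FwE.
by rewrite !(JC _ w) !(JC a) !(JC b); lra.
Qed.

(** Here [F x y] is [u] wedge [J y]. Removing the Kulkarni-Nomizu product of [uu] and [J] leaves a
    tensor to which [curvature_wedge_form] applies, and the two pieces are then merged into one
    square. *)
Lemma curvature_gauss_form F x w w1 : curvature_tensor F ->
  (forall x y a b c d, F x y a b * F x y c d - F x y a c * F x y b d +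
     F x y a d * F x y b c = 0) ->
  F x w x w != 0 -> F x w x w * F x w1 x w1 != F x w x w1 * F x w x w1 ->
  (forall u : V -> R, (forall t y z, u (t *: y + z) = t * u y + u z) ->
     exists y z a b, [/\ u y = 0, u z = 0 & F y z a b != 0]) ->
  exists c h, [/\ c != 0, symm_bilinear h &
    forall y z a b, F y z a b = c * (h y a * h z b - h y b * h z a)].
Proof.
move=> cF decF Jw w1P nondeg.
have [u uP [ux uE]] := jacobi_factor cF decF Jw w1P.
pose J y z := F x y x z.
have sJ : symm_bilinear J := jacobi_form cF x.
have [JP JC] := sJ.
have Jx y : J x y = 0 by rewrite /J curv_diag.
pose uu (y z : V) := u y * u z.
have suu : symm_bilinear uu.
  by split=> [t y z a|y z]; rewrite /uu ?uP; ring.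
(* x lies in the kernel of F', and F' y z is divisible by J_y. *)
pose F' y z a b := F y z a b - kulkarni_nomizu uu J y z a b.
have cF' : curvature_tensor F'.
  exact: curvature_tensorB cF (kulkarni_nomizu_curvature suu sJ).
have wedge0 y z b c d : J y b * F' z y c d - J y c * F' z y b d +
    J y d * F' z y b c = 0.
  have {}uE s p q : F x s p q = u p * J s q - u q * J s p := uE s p q.
  have zyx s : F z y x s = u z * J s y - u y * J s z.
    by rewrite (curvC cF) uE.
  (* The mixed part of the decomposability relation at [x + z], contracted with [x]; the terms in
     [u] are those of the subtracted product. *)
  have := decF (x + z) y x b c d; rewrite !(curvD1 cF).
  have := decF x y x b c d; have := decF z y x b c d.
  rewrite !zyx !uE /F' /kulkarni_nomizu /uu ux.
  rewrite (JC y x) Jx (JC b y) (JC c y) (JC d y) (JC b z) (JC c z) (JC d z).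
  lra.
have [c F'E] := curvature_wedge_form cF' sJ wedge0 Jw w1P.
have FE y z a b : F y z a b =
    kulkarni_nomizu uu J y z a b + c * (J y a * J z b - J y b * J z a).
  by rewrite -F'E /F'; ring.
(* If [c] were zero, [F] would vanish on pairs from the kernel of [u], against [nondeg]. *)
have c0 : c != 0.
  have [y [z [a [b [uy uz]]]]] := nondeg u uP.
  by apply: contraNneq => c0; rewrite FE c0 /kulkarni_nomizu /uu uy uz; lra.
(* Completing the square: the Kulkarni-Nomizu square of [uu] is zero, because [uu] has rank at most
   one. *)
exists c, (fun y z => J y z + uu y z / c); split=> //.
  split=> [t y z a|y z]; last by rewrite JC (suu.2 y).
  by rewrite JP suu.1; ring.
by move=> y z a b; rewrite FE /kulkarni_nomizu /uu; field.
Qed.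

End KulkarniNomizu.

(** * Spacelike pairs and Zariski density *)

Section CurvatureTensorFacts.
Variables (R : realFieldType) (V : lmodType R).
Implicit Types (F : V -> V -> V -> V -> R).

(** Polarizing twice makes [F] skew in its first and third arguments; all three terms of the Bianchi
    identity then equal [F x y z w]. *)
Lemma sectional_eq0 F : curvature_tensor F -> (forall x y, F x y x y = 0) ->
  forall x y z w, F x y z w = 0.
Proof.
move=> cF F0.
have {}F0 x y z : F x y x z = 0.
  exact: (symm_bilinear_eq0 (jacobi_form cF x)).
have F13 x y z w : F x y z w = - F z y x w.
  by have := F0 (1 *: x + z) y w; rewrite (curvP cF) !(curvP3 cF) !F0; lra.
move=> x y z w.
have := curv_bianchi cF x y z w.
have := F13 z x y w; have := F13 y z x w.
rewrite (curvN cF y x) (curvN cF x z); lra.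
Qed.

(* Some 3 x 3 minors of a skew matrix are products of an entry and the
   Pfaffian of a 4 x 4 submatrix. *)
Lemma skew_rank2_pfaffian (S : V -> V -> R) (f g h k : V -> R) :
  (forall a b, S a b = - S b a) ->
  (forall a b, S a b = f a * g b + h a * k b) ->
  forall a b c d, S a b * S c d - S a c * S b d + S a d * S b c = 0.
Proof.
move=> SN SE.
pose pf a b c d := S a b * S c d - S a c * S b d + S a d * S b c.
have S0 a : S a a = 0 by have := SN a a; lra.
have SP a b c d : S a b * pf a b c d = 0.
  have : S a a * (S b b * S c d - S b d * S c b)
       - S a b * (S b a * S c d - S b d * S c a)
       + S a d * (S b a * S c b - S b b * S c a) = 0.
    by rewrite !SE; ring.
  rewrite !S0 (SN b a) (SN c a) (SN c b) /pf; lra.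
(* Permuting indices changes [pf] only by a sign, so [S a b], [S a c] and [S a d] all annihilate it.
   Expanding one factor of [pf ^+ 2] gives zero. *)
move=> a b c d; apply/eqP; rewrite -/(pf a b c d) -sqrf_eq0; apply/eqP.
have := SP a b c d; have := SP a c b d; have := SP a d b c.
rewrite /pf (SN c b) (SN d b) (SN d c) => e1 e2 e3.
have := congr1 ( *%R (S c d)) e3; have := congr1 ( *%R (S b d)) e2.
by have := congr1 ( *%R (S b c)) e1; rewrite !mulr0; lra.
Qed.

End CurvatureTensorFacts.

Lemma horner_eq0_of_gt (R : realFieldType) (p : {poly R}) s0 :
  (forall s, s0 < s -> p.[s] = 0) -> forall s, p.[s] = 0.
Proof.
move=> ps s; suff -> : p = 0 by rewrite horner0.
apply/eqP; apply: contraT => p0.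
have := @max_poly_roots _ p [seq s0 + i.+1%:R | i <- iota 0 (size p)] p0.
rewrite size_map size_iota ltnn; apply.
- by apply/allP => _ /mapP[i _ ->]; apply/rootP/ps; rewrite ltrDl ltr0n.
- rewrite map_inj_uniq ?iota_uniq// => i j /addrI/eqP.
  by rewrite eqr_nat => /eqP[].
Qed.

Section SpacelikePairs.
Variables (R : realType) (V : lmodType R) (g : V -> V -> R).
Hypothesis sg : symm_bilinear g.
Implicit Types x y z : V.

Definition gram2 (h : V -> V -> R) y z : R := h y y * h z z - (h y z) ^+ 2.

Definition spacelike_pair y z := 0 < g y y /\ 0 < gram2 g y z.

(** For large [s] the diagonal Gram entries exceed [s ^+ 2 / 2], while the mixed entry grows only
    linearly and stays below [s ^+ 2 / 4] in absolute value. The bound [m] dominates all the lower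
    order coefficients. *)
Lemma eventually_spacelike_pair e1 e2 x y : g e1 e1 = 1 -> g e2 e2 = 1 ->
  g e1 e2 = 0 ->
  exists s0, forall s, s0 < s -> spacelike_pair (s *: e1 + x) (s *: e2 + y).
Proof.
move=> g11 g22 g12; have [gP gC] := sg.
pose m := 1 + `|g e1 x| + `|g e2 y| + `|g x x| + `|g y y| + `|g e1 y|
  + `|g x e2| + `|g x y|.
exists (10 * m) => s ms.
have ab (u v : R) : `|u| <= v -> - v <= u <= v by rewrite ler_norml.
have [a1 a2 a3 a4] : [/\ - m <= g e1 x <= m, - m <= g e2 y <= m,
    - m <= g x x <= m & - m <= g y y <= m].
  by split; apply: ab; rewrite /m;
  move: (normr_ge0 (g e1 x)) (normr_ge0 (g e2 y)) (normr_ge0 (g x x))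
   (normr_ge0 (g y y)) (normr_ge0 (g e1 y)) (normr_ge0 (g x e2))
   (normr_ge0 (g x y)); lra.
have [b1 b2 b3 m1] : [/\ - m <= g e1 y <= m, - m <= g x e2 <= m,
    - m <= g x y <= m & 1 <= m].
  by split; try apply: ab; rewrite /m;
  move: (normr_ge0 (g e1 x)) (normr_ge0 (g e2 y)) (normr_ge0 (g x x))
   (normr_ge0 (g y y)) (normr_ge0 (g e1 y)) (normr_ge0 (g x e2))
   (normr_ge0 (g x y)); lra.
have s1 : 10 <= s by lra.
have yy (e z : V) : g e e = 1 -> - m <= g e z <= m -> - m <= g z z <= m ->
    s ^+ 2 / 2 < g (s *: e + z) (s *: e + z).
  move=> ge h1 h2; rewrite !(gP, symm_bilinearPr _ _ _ _ sg) ge (gC z e).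
  by move/andP: h1 => [? ?]; move/andP: h2 => [? ?]; nra.
have A := yy e1 x g11 a1 a3; have B := yy e2 y g22 a2 a4.
have C : - (s ^+ 2 / 4) <= g (s *: e1 + x) (s *: e2 + y) <= s ^+ 2 / 4.
  rewrite !(gP, symm_bilinearPr _ _ _ _ sg) g12.
  move/andP: b1 => [? ?]; move/andP: b2 => [? ?]; move/andP: b3 => [? ?].
  by apply/andP; split; nra.
move: A B C; rewrite /spacelike_pair /gram2.
move: (g _ _) (g _ _) (g _ _) => c b a A B C.
have s2 : 0 < s ^+ 2 by rewrite exprn_gt0//; lra.
split; first by lra.
have : (s ^+ 2 / 2) * (s ^+ 2 / 2) < a * b by apply: ltr_pM; lra.
have : c ^+ 2 <= (s ^+ 2 / 4) ^+ 2.
  rewrite -ler_sqrt ?sqr_ge0// !sqrtr_sqr [X in _ <= X]ger0_norm; last by lra.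
  by rewrite ler_norml.
have : 0 < (s ^+ 2 / 4) ^+ 2 by rewrite exprn_gt0//; lra.
lra.
Qed.

(* Zariski density: s *: (e1 + s^-1 *: x) is a rescaled perturbation of e1, so
   s = 0 recovers an arbitrary pair x, y. *)
Lemma horner0_eq0_of_spacelike e1 e2 x y (p : {poly R}) : g e1 e1 = 1 ->
  g e2 e2 = 1 -> g e1 e2 = 0 ->
  (forall s, spacelike_pair (s *: e1 + x) (s *: e2 + y) -> p.[s] = 0) ->
  p.[0] = 0.
Proof.
move=> g11 g22 g12 ps.
have [s0 sP] := eventually_spacelike_pair x y g11 g22 g12.
by apply: (horner_eq0_of_gt (s0 := s0)) => s /sP; exact: ps.
Qed.

End SpacelikePairs.

(** * Spacelike planes in the kernel of a covector *)

Section SpacelikeKernels.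
Variables (R : realType) (V : lmodType R) (g : V -> V -> R) (e1 e2 e3 : V).
Hypothesis sg : symm_bilinear g.
Hypotheses (g11 : g e1 e1 = 1) (g22 : g e2 e2 = 1) (g33 : g e3 e3 = 1).
Hypotheses (g12 : g e1 e2 = 0) (g13 : g e1 e3 = 0) (g23 : g e2 e3 = 0).
Variable u : V -> R.
Hypothesis uP : forall t x y, u (t *: x + y) = t * u x + u y.

(** The kernel of [u] meets the positive definite span of [e1, e2, e3] in dimension at least 2; a
    nonzero [u e3] or [u e2] serves as pivot. *)
Lemma spacelike_pair_in_kernel :
  exists y z, [/\ u y = 0, u z = 0 & spacelike_pair g y z].
Proof.
have [gP gC] := sg; have gPr := symm_bilinearPr _ _ _ _ sg.
have g21 : g e2 e1 = 0 by rewrite gC.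
have g31 : g e3 e1 = 0 by rewrite gC.
have g32 : g e3 e2 = 0 by rewrite gC.
rewrite /spacelike_pair /gram2.
have [u30|u30] := eqVneq (u e3) 0; last first.
  exists (- (u e1 / u e3) *: e3 + e1), (- (u e2 / u e3) *: e3 + e2).
  split; rewrite ?uP ?gP ?gPr; [by field|by field|].
  rewrite g11 g22 g33 g13 g31 g23 g32 g12.
  set a := u e1 / _; set b := u e2 / _.
  by split; have := sqr_ge0 a; have := sqr_ge0 b; nra.
have [u20|u20] := eqVneq (u e2) 0.
  by exists e2, e3; rewrite u20 u30 g22 g33 g23; split=> //; split; lra.
exists e3, (- (u e1 / u e2) *: e2 + e1); split; rewrite ?uP ?gP ?gPr//.
  by field.
rewrite g11 g22 g33 g32 g31 g12 g21.
by split; have := sqr_ge0 (u e1 / u e2); nra.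
Qed.

(** A spacelike plane in the kernel of [u] contains a nonzero vector orthogonal to [x]. *)
Lemma spacelike_pair_with_kernel x : 0 < g x x ->
  exists2 c, u c = 0 & spacelike_pair g x c.
Proof.
have [gP gC] := sg; have gPr := symm_bilinearPr _ _ _ _ sg.
move=> gx; have [y [z [uy uz [gy gyz]]]] := spacelike_pair_in_kernel.
suff [c [uc gxc gc]] : exists c, [/\ u c = 0, g x c = 0 & 0 < g c c].
  exists c => //; split=> //; rewrite /gram2 gxc expr0n subr0.
  exact: mulr_gt0.
have [xy|xy] := eqVneq (g x y) 0; first by exists y.
exists (- (g x z / g x y) *: y + z); split.
- by rewrite uP uy uz; ring.
- by rewrite gPr; field.
rewrite gP !gPr (gC z y) -(pmulr_rgt0 _ gy).
move: gyz; rewrite /gram2 => gyz.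
by have := sqr_ge0 (- (g x z / g x y) * g y y + g y z); lra.
Qed.

End SpacelikeKernels.

(** * The Gauss equation from constant rank 2 *)

Section ConstantRankTwo.
Variables (R : realType) (V : lmodType R) (g : V -> V -> R) (e1 e2 e3 : V).
Hypothesis sg : symm_bilinear g.
Hypotheses (g11 : g e1 e1 = 1) (g22 : g e2 e2 = 1) (g33 : g e3 e3 = 1).
Hypotheses (g12 : g e1 e2 = 0) (g13 : g e1 e3 = 0) (g23 : g e2 e3 = 0).

Lemma spacelike_pair_orthonormal : spacelike_pair g e1 e2.
Proof. by rewrite /spacelike_pair /gram2 g11 g22 g12; split; lra. Qed.

Section Density.
Variable F : V -> V -> V -> V -> R.
Hypothesis cF : curvature_tensor F.

Lemma curvature_poly x y : exists p : V -> V -> {poly R}, forall a b s,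
  (p a b).[s] = F (s *: e1 + x) (s *: e2 + y) a b.
Proof.
exists (fun a b => (F e1 e2 a b)%:P * 'X^2 + (F e1 y a b + F x e2 a b)%:P * 'X
  + (F x y a b)%:P) => a b s.
rewrite !(hornerD, hornerM, hornerXn, hornerX, hornerC).
by rewrite (curvP cF) !(curvP2 cF); ring.
Qed.

Lemma sectional_poly x y : exists p : {poly R}, forall s,
  p.[s] = F (s *: e1 + x) (s *: e2 + y) (s *: e1 + x) (s *: e2 + y).
Proof.
have [p pE] := curvature_poly x y.
exists (p e1 e2 * 'X^2 + (p e1 y + p x e2) * 'X + p x y) => s.
rewrite !(hornerD, hornerM, hornerXn, hornerX) !pE.
by rewrite (curvP3 cF) !(curvP4 cF); ring.
Qed.

Lemma decomposable_of_spacelike :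
  (forall x y, spacelike_pair g x y -> forall a b c d,
     F x y a b * F x y c d - F x y a c * F x y b d + F x y a d * F x y b c = 0)
  -> forall x y a b c d,
     F x y a b * F x y c d - F x y a c * F x y b d + F x y a d * F x y b c = 0.
Proof.
move=> decF x y a b c d; have [p pE] := curvature_poly x y.
pose q := p a b * p c d - p a c * p b d + p a d * p b c.
have qE s : q.[s] = let F' := F (s *: e1 + x) (s *: e2 + y) in
    F' a b * F' c d - F' a c * F' b d + F' a d * F' b c.
  by rewrite /q !(hornerD, hornerN, hornerM) !pE.
have := @horner0_eq0_of_spacelike _ _ g sg e1 e2 x y q g11 g22 g12.
rewrite qE !scale0r !add0r; apply => s sp.
by rewrite qE; exact: decF.
Qed.

Lemma curvature_eq0_of_spacelike :
  (forall x y, spacelike_pair g x y -> F x y x y = 0) ->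
  forall x y z w, F x y z w = 0.
Proof.
move=> F0; apply: sectional_eq0 => // x y.
have [p pE] := sectional_poly x y.
have := @horner0_eq0_of_spacelike _ _ g sg e1 e2 x y p g11 g22 g12.
by rewrite pE !scale0r !add0r; apply => s sp; rewrite pE F0.
Qed.

Hypothesis rank2 : forall x y, spacelike_pair g x y ->
  exists f h k l : V -> R, forall a b, F x y a b = f a * h b + k a * l b.
Hypothesis rank_neq0 : forall x y, spacelike_pair g x y ->
  exists a b, F x y a b != 0.

(** If some Jacobi form has rank at least 2, [curvature_gauss_form] applies. Otherwise take a
    spacelike [x] with nonzero Jacobi form: [jacobi_rank1] makes [F x c] vanish for all [c] in the
    kernel of a covector, and some such [c] forms a spacelike pair with [x], contradicting
    [rank_neq0]. *)
Theorem constant_rank2_gauss : exists c h, [/\ c != 0, symm_bilinear h &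
  forall y z a b, F y z a b = c * (h y a * h z b - h y b * h z a)].
Proof.
have decF : forall x y a b c d,
    F x y a b * F x y c d - F x y a c * F x y b d + F x y a d * F x y b c = 0.
  apply: decomposable_of_spacelike => x y /rank2[f [h [k [l FE]]]].
  exact: skew_rank2_pfaffian (curvNr cF x y) FE.
have nondeg u : (forall t y z, u (t *: y + z) = t * u y + u z) ->
    exists y z a b, [/\ u y = 0, u z = 0 & F y z a b != 0].
  move=> uP.
  have [y [z [uy uz /rank_neq0[a [b Fab]]]]] :=
    spacelike_pair_in_kernel sg g11 g22 g33 g12 g13 g23 uP.
  by exists y, z, a, b.
have [[x [w [w1 [Jw w1P]]]]|rk1] := pselect (exists x w w1, F x w x w != 0 /\
  F x w x w * F x w1 x w1 != F x w x w1 * F x w x w1).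
  exact: curvature_gauss_form cF decF Jw w1P nondeg.
have {}rk1 x w w1 : F x w x w != 0 ->
    F x w x w * F x w1 x w1 = F x w x w1 * F x w x w1.
  by move=> Jw; apply: contrapT => /eqP ?; apply: rk1; exists x, w, w1.
have [x [w [[gx _] Jw]]] : exists x w, spacelike_pair g x w /\ F x w x w != 0.
  apply: contrapT => noJ.
  have [a [b]] := rank_neq0 spacelike_pair_orthonormal.
  rewrite curvature_eq0_of_spacelike ?eqxx// => x w xw.
  by apply: contrapT => /eqP Jw; apply: noJ; exists x, w.
(* The principal minors through a vector [v] with nonzero Jacobi value force the form to be a
   multiple of the square of one covector, so all its 2 x 2 minors vanish. *)
have minors x' a b c d :
    F x' a x' b * F x' c x' d = F x' a x' d * F x' c x' b.
  have sJ := jacobi_form cF x'.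
  have [[v Jv]|J0] := pselect (exists v, F x' v x' v != 0); last first.
    have J0' : forall y z, F x' y x' z = 0.
      apply: (symm_bilinear_eq0 sJ) => v.
      by apply: contrapT => /eqP Jv; apply: J0; exists v.
    by rewrite !J0' !mul0r.
  have sJ' : symm_bilinear (fun y z => F x' v x' v * F x' y x' z -
      F x' v x' y * F x' v x' z).
    split=> [t y z s|y z]; last by rewrite (curvC cF x' y); ring.
    by rewrite (curvP2 cF) (curvP4 cF); ring.
  have JE y z : F x' v x' v * F x' y x' z = F x' v x' y * F x' v x' z.
    apply/eqP; rewrite -subr_eq0; apply/eqP.
    by apply: (symm_bilinear_eq0 sJ') => y'; rewrite rk1// subrr.
  apply: (mulfI Jv); apply: (mulfI Jv).
  transitivity ((F x' v x' v * F x' a x' b) * (F x' v x' v * F x' c x' d)).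
    by ring.
  transitivity ((F x' v x' v * F x' a x' d) * (F x' v x' v * F x' c x' b)).
    by rewrite !JE; ring.
  by ring.
have ker0 := jacobi_rank1 cF decF minors Jw.
have [|c uc xc] := @spacelike_pair_with_kernel _ _ g e1 e2 e3 sg g11 g22 g33 g12
  g13 g23 (fun c => F x c x w) _ x gx.
  by move=> t y z; rewrite (curvP2 cF).
by have [a [b]] := rank_neq0 xc; rewrite ker0 ?eqxx.
Qed.

End Density.
End ConstantRankTwo.

(** * Model spaces *)

Lemma row_form_mx (F : fieldType) n k (E : 'M[F]_(k, n)) (A : 'M[F]_n) i j :
  (row i E *m A *m (row j E)^T) 0 0 = (E *m A *m E^T) i j.
Proof.
rewrite -row_mul tr_row [LHS]mxE [RHS]mxE; apply: eq_bigr => s _.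
by rewrite [row _ _ _ _]mxE [col _ _ _ _]mxE.
Qed.

(** * Conjugacy of matrices with a scalar reversed product *)

Section SimilarMatrices.
Variable F : fieldType.

(** The relation forces [C] to have rank [k]. The size is returned as [k + r] so that [B] and [K]
    can be stacked into a square matrix. *)
Lemma kernel_basis n k (C : 'M[F]_(n, k)) (B : 'M[F]_(k, n)) mu : mu != 0 ->
  B *m C = mu%:M ->
  exists r (K : 'M[F]_(r, n)), [/\ n = (k + r)%N, row_free K & K *m C = 0].
Proof.
move=> mu0 BC.
have rC : \rank C = k.
  apply/eqP; rewrite eqn_leq rank_leq_col /=.
  have : (\rank (B *m C) <= \rank C)%N by exact: mxrankM_maxr.
  by rewrite BC -scalemx1 mxrank_scale_nz// mxrank1.
exists (\rank (kermx C)), (row_base (kermx C)); split.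
- by rewrite mxrank_ker rC subnKC// -rC rank_leq_row.
- exact: row_base_free.
- by apply/sub_kermxP; rewrite eq_row_base.
Qed.

(** The rows of [B] are left eigenvectors of [C *m B] for [mu], those of [K] for 0; as [mu] is
    nonzero, together they form a basis. *)
Lemma diagonalize_factored k r (C : 'M[F]_(k + r, k)) (B : 'M[F]_(k, k + r))
    (K : 'M[F]_(r, k + r)) mu : mu != 0 ->
  B *m C = mu%:M -> row_free K -> K *m C = 0 ->
  col_mx B K \in unitmx /\
  col_mx B K *m (C *m B) = block_mx mu%:M 0 0 0 *m col_mx B K.
Proof.
move=> mu0 BC fK KC; split; last first.
  rewrite mul_col_mx !mulmxA BC KC mul0mx mul_block_col !mul0mx !addr0.
  by rewrite !mul_scalar_mx.
rewrite -row_free_unit; apply: inj_row_free => v.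
rewrite -[v]hsubmxK mul_row_col => e.
have l0 : lsubmx v = 0.
  have := congr1 (mulmxr C) e; rewrite /= mulmxDl -!mulmxA BC KC mulmx0 addr0.
  rewrite mul0mx mul_mx_scalar => /eqP.
  by rewrite scaler_eq0 (negPf mu0) => /eqP.
rewrite l0 mul0mx add0r in e.
have r0 : rsubmx v = 0 by apply: (row_free_inj fK); rewrite e mul0mx.
by rewrite l0 r0 row_mx0.
Qed.

Lemma similar_factored n k (C1 C2 : 'M[F]_(n, k)) (B1 B2 : 'M[F]_(k, n)) mu :
  mu != 0 -> B1 *m C1 = mu%:M -> B2 *m C2 = mu%:M ->
  exists2 P : 'M[F]_n, P \in unitmx & conjmx P (C1 *m B1) = C2 *m B2.
Proof.
move=> mu0 BC1 BC2.
have [r [K1 [nE fK1 KC1]]] := kernel_basis mu0 BC1.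
have [r2 [K2 [nE2 fK2 KC2]]] := kernel_basis mu0 BC2.
have er : r2 = r by apply/(@addnI k); rewrite -nE -nE2.
subst r2 n => {nE2}.
have [U1 E1] := diagonalize_factored mu0 BC1 fK1 KC1.
have [U2 E2] := diagonalize_factored mu0 BC2 fK2 KC2.
set P1 := col_mx B1 K1 in U1 E1; set P2 := col_mx B2 K2 in U2 E2.
have UP : invmx P2 *m P1 \in unitmx by rewrite unitmx_mul unitmx_inv U2.
exists (invmx P2 *m P1) => //.
rewrite conjumx//; apply: (canLR (mulmxK UP)).
by rewrite -mulmxA E1 -[in RHS](mulKmx U2 (C2 *m B2)) E2 !mulmxA mulmxK.
Qed.

End SimilarMatrices.

(** * Curvature operators given by a Gauss equation *)

Section GaussOperators.
Variables (R : realType) (n : nat) (G H : 'M[R]_n) (c : R).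
Hypotheses (GT : G^T = G) (HT : H^T = H).
Implicit Types x y z : 'rV[R]_n.

(** On row vectors this is w |-> c (h(w, y) phi z - h(w, z) phi y), where [H] is the matrix of h and
    phi z is [z *m H *m invmx G]. *)
Definition gauss_op y z : 'M[R]_n :=
  c *: ((y *m H)^T *m (z *m H *m invmx G) - (z *m H)^T *m (y *m H *m invmx G)).

(** For symmetric [H] and symmetric invertible [G], the matrix of the form g(phi y, phi z). *)
Definition gauss_sqr : 'M[R]_n := H *m invmx G *m H.

Definition gauss_form y z : R := (y *m gauss_sqr *m z^T) 0 0.

Lemma gauss_sqr_tr : gauss_sqr^T = gauss_sqr.
Proof. by rewrite !trmx_mul trmx_inv GT HT mulmxA. Qed.

Lemma gauss_form_symm_bilinear : symm_bilinear gauss_form.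
Proof.
split=> [t x y z|x y]; rewrite /gauss_form.
  by rewrite !mulmxDl -!scalemxAl !mxE.
have -> : y *m gauss_sqr *m x^T = (x *m gauss_sqr *m y^T)^T.
  by rewrite trmx_mul trmxK trmx_mul gauss_sqr_tr mulmxA.
by rewrite [RHS]mxE.
Qed.

Lemma gauss_pairing y z :
  z *m H *m invmx G *m (y *m H)^T = (gauss_form z y)%:M.
Proof. by rewrite [LHS]mx11_scalar /gauss_form trmx_mul HT !mulmxA. Qed.

Lemma bivector_sqr (u v : 'cV[R]_n) (r s : 'rV[R]_n) a b d :
  r *m u = a%:M -> s *m v = b%:M -> r *m v = d%:M -> s *m u = d%:M ->
  (u *m s - v *m r) *m (u *m s - v *m r) =
  d *: (u *m s + v *m r) - b *: (u *m r) - a *: (v *m s).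
Proof.
move=> ru sv rv su.
have key (x y : 'cV[R]_n) (w t : 'rV[R]_n) k : t *m x = k%:M ->
    y *m t *m (x *m w) = k *: (y *m w).
  by move=> tx; rewrite mulmxA -(mulmxA y) tx mul_mx_scalar -scalemxAl.
rewrite !(mulmxBl, mulmxBr) (key _ _ _ _ _ su) (key _ _ _ _ _ sv).
rewrite (key _ _ _ _ _ ru) (key _ _ _ _ _ rv) scalerDr.
by rewrite opprB addrA; congr (_ + _); rewrite addrAC.
Qed.

Lemma gauss_op_sqr y z : gauss_op y z *m gauss_op y z = c ^+ 2 *:
  (gauss_form y z *: ((y *m H)^T *m (z *m H *m invmx G)
     + (z *m H)^T *m (y *m H *m invmx G))
   - gauss_form z z *: ((y *m H)^T *m (y *m H *m invmx G))
   - gauss_form y y *: ((z *m H)^T *m (z *m H *m invmx G))).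
Proof.
rewrite /gauss_op -scalemxAl -scalemxAr scalerA -expr2; congr (_ *: _).
apply: bivector_sqr; rewrite gauss_pairing//.
by rewrite gauss_form_symm_bilinear.2.
Qed.

Lemma mxtrace_gauss_op_sqr y z :
  \tr (gauss_op y z *m gauss_op y z) = - (2 * c ^+ 2 * gram2 gauss_form y z).
Proof.
have tr u v : \tr ((u *m H)^T *m (v *m H *m invmx G)) = gauss_form v u.
  by rewrite mxtrace_mulC gauss_pairing mxtrace_scalar mulr1n.
rewrite gauss_op_sqr mxtraceZ !raddfB /= !(mxtraceZ, mxtraceD) !tr.
rewrite (gauss_form_symm_bilinear.2 z y) /gram2; ring.
Qed.

Lemma gauss_op_sqr_isotropic y z : gauss_form y y = 0 -> gauss_form z z = 0 ->
  gauss_form y z = 0 -> gauss_op y z *m gauss_op y z = 0.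
Proof.
by move=> y0 z0 yz0; rewrite gauss_op_sqr y0 z0 yz0 !scale0r !subr0 scaler0.
Qed.

Lemma gauss_op_factor y z : gauss_op y z =
  (c *: row_mx (y *m H)^T (z *m H)^T) *m
  col_mx (z *m H *m invmx G) (- (y *m H *m invmx G)).
Proof. by rewrite -scalemxAl mul_row_col mulmxN. Qed.

(** In the factorization [C *m B] through dimension 2, rank 2 makes [C] injective and [B] surjective
    as column operators, so a zero square forces [B *m C = 0]; its lower left block is
    [gauss_form y y] up to the factor [- c]. *)
Lemma gauss_op_sqr_eq0 y z : \rank (gauss_op y z) = 2%N ->
  gauss_op y z *m gauss_op y z = 0 -> gauss_form y y = 0.
Proof.
rewrite gauss_op_factor; set C := (c *: _); set B := col_mx _ _ => rk CB0.
have rB : row_free B.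
  rewrite /row_free eqn_leq rank_leq_row -[X in (X <= _)%N]rk.
  exact: mxrankM_maxr.
have rC : row_full C.
  rewrite /row_full eqn_leq rank_leq_col -[X in (X <= _)%N]rk.
  exact: mxrankM_maxl.
have : B *m C = 0.
  apply: (row_full_inj rC); apply: (row_free_inj rB).
  by rewrite /= mulmx0 mul0mx -CB0 !mulmxA.
have c0 : c != 0.
  by apply: contra_eq_neq rk => c0; rewrite /C c0 scale0r mul0mx mxrank0.
rewrite /B /C -scalemxAr mul_col_row => /eqP; rewrite scaler_eq0 (negPf c0) /=.
move=> /eqP/(congr1 (@dlsubmx _ _ _ _ _)); rewrite block_mxKdl mulNmx.
rewrite gauss_pairing => /(congr1 (fun A : 'M[R]_1 => A 0 0)).
by rewrite !mxE eqxx mulr1n => /eqP; rewrite oppr_eq0 => /eqP.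
Qed.

(** For [gauss_form]-orthogonal rows, the square for [i, j] is [c ^+ 2 * mu] times twice
    [h i *m r i] when [i = j], minus [h i *m r i] and [h j *m r j]. Summation gives 2 - k - k copies
    of the total. *)
Lemma gauss_op_sum k (E : 'M[R]_(k, n)) mu : E *m gauss_sqr *m E^T = mu%:M ->
  \sum_(i < k) \sum_(j < k) gauss_op (row i E) (row j E) *m
    gauss_op (row i E) (row j E) =
  (2 * c ^+ 2 * mu * (1 - k%:R)) *: ((E *m H)^T *m (E *m H *m invmx G)).
Proof.
move=> EE.
pose h i : 'cV[R]_n := (row i E *m H)^T.
pose r i : 'rV[R]_n := row i E *m H *m invmx G.
have LE i j : gauss_form (row i E) (row j E) = mu * (i == j)%:R.
  by rewrite /gauss_form row_form_mx EE mxE mulr_natr.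
have QE : (E *m H)^T *m (E *m H *m invmx G) = \sum_i (h i *m r i).
  apply/matrixP => a b; rewrite mxE summxE; apply: eq_bigr => i _.
  by rewrite /h /r -!row_mul [RHS]mxE big_ord1 !mxE.
have opE i j : gauss_op (row i E) (row j E) *m gauss_op (row i E) (row j E) =
    (c ^+ 2 * mu) *: (((i == j)%:R *: (h i *m r i)) *+ 2
      - (h i *m r i) - (h j *m r j)).
  rewrite gauss_op_sqr !LE !eqxx !mulr1 -/(h i) -/(h j) -/(r i) -/(r j).
  have dE : (i == j)%:R *: (h i *m r j + h j *m r i) =
      ((i == j)%:R *: (h i *m r i)) *+ 2.
    have [->|_] := eqVneq i j; last by rewrite !scale0r mul0rn.
    by rewrite scale1r mulr2n scale1r.
  by rewrite -!scalerA -!scalerBr dE.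
clearbody h r.
have sumj i : \sum_j gauss_op (row i E) (row j E) *m
    gauss_op (row i E) (row j E) =
    (c ^+ 2 * mu) *: ((h i *m r i) *+ 2 - (h i *m r i) *+ k
      - \sum_j (h j *m r j)).
  under eq_bigr do rewrite opE.
  rewrite -scaler_sumr !sumrB sumr_const card_ord (bigD1 i)//= eqxx scale1r.
  rewrite big1 ?addr0// => j ji.
  by rewrite eq_sym (negPf ji) scale0r mul0rn.
under eq_bigr do rewrite sumj.
rewrite -scaler_sumr !sumrB !sumrMnl sumr_const card_ord QE.
set Q := \sum_i _.
have -> : 2 * c ^+ 2 * mu * (1 - k%:R) = c ^+ 2 * mu * (2 - k%:R - k%:R).
  by ring.
by rewrite -[RHS]scalerA !scalerBl !scaler_nat.
Qed.

End GaussOperators.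

(** * Matrices of given signature *)

Section Signature.
Variables (R : realType) (p q : nat).

Definition signature_mx : 'M[R]_(p + q) := block_mx (- 1%:M) 0 0 1%:M.

Lemma signature_mx_sqr : signature_mx *m signature_mx = 1%:M.
Proof.
rewrite mulmx_block !(mul0mx, mulmx0) mulNmx mulmxN opprK !mul1mx.
by rewrite !(addr0, add0r) -scalar_mx_block.
Qed.

Lemma has_signature_tr (G : 'M[R]_(p + q)) : has_signature G -> G^T = G.
Proof.
case=> B uB /(congr1 (fun A => invmx B *m A *m invmx B^T)).
have uBT : B^T \in unitmx by rewrite unitmx_tr.
rewrite -!mulmxA mulmxV// mulmx1 mulKmx// => ->.
rewrite !trmx_mul tr_block_mx !trmx0 linearN /= !trmx1 !trmx_inv trmxK.
by rewrite mulmxA.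
Qed.

Lemma has_signature_unit (G : 'M[R]_(p + q)) : has_signature G -> G \in unitmx.
Proof.
case=> B uB E; have := mulmx1_unit signature_mx_sqr.
by rewrite /signature_mx -E !unitmx_mul => -[/andP[/andP[_ ->]]].
Qed.

Lemma signature_mx_off (i j : 'I_(p + q)) : i != j -> signature_mx i j = 0.
Proof.
case: (split_ordP i) => i' ->; case: (split_ordP j) => j' -> ij.
- have /negPf ij' : i' != j' by apply: contraNneq ij => ->.
  by rewrite block_mxEul !mxE ij' oppr0.
- by rewrite block_mxEur mxE.
- by rewrite block_mxEdl mxE.
- have /negPf ij' : i' != j' by apply: contraNneq ij => ->.
  by rewrite block_mxEdr !mxE ij'.
Qed.

Lemma signature_mx_diag (i : 'I_(p + q)) :
  signature_mx i i * signature_mx i i = 1.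
Proof.
case: (split_ordP i) => i' ->.
  by rewrite block_mxEul !mxE eqxx mulrNN mulr1.
by rewrite block_mxEdr !mxE eqxx mulr1.
Qed.

End Signature.

(** * Invariants of conjugacy classes *)

Section JordanInvariants.
Variables (R : realType) (n : nat).
Implicit Types A B : 'M[R]_n.

Lemma jordan_equivalent_sqr A B : jordan_equivalent A B ->
  jordan_equivalent (A *m A) (B *m B).
Proof.
case=> P uP <-; exists P => //; rewrite !conjumx// !mulmxA.
by congr (_ *m _); rewrite mulmxKV.
Qed.

Lemma jordan_equivalentZ a A B : jordan_equivalent A B ->
  jordan_equivalent (a *: A) (a *: B).
Proof.
by case=> P uP <-; exists P => //; rewrite !conjumx// -scalemxAr -scalemxAl.
Qed.

Lemma jordan_equivalent_tr A B : jordan_equivalent A B -> \tr A = \tr B.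
Proof. by case=> P uP <-; rewrite conjumx// mxtrace_mulC mulKmx. Qed.

Lemma jordan_equivalent0 B : jordan_equivalent 0 B -> B = 0.
Proof. by case=> P uP <-; rewrite conjumx// mulmx0 mul0mx. Qed.

End JordanInvariants.

(** * Gram determinants under change of basis *)

Section Gram.
Variables (R : realType) (V : lmodType R) (h : V -> V -> R).
Hypothesis sh : symm_bilinear h.

Lemma symm_bilinear0 x : h x 0 = 0.
Proof. by have := symm_bilinearPr 1 x 0 0 sh; rewrite scale1r addr0; lra. Qed.

Lemma symm_bilinearZZ s t x y : h (s *: x) (t *: y) = s * t * h x y.
Proof.
have hZ a z w : h z (a *: w) = a * h z w.
  by rewrite -[a *: w]addr0 symm_bilinearPr// symm_bilinear0 addr0.
by rewrite hZ sh.2 hZ sh.2 mulrCA mulrA.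
Qed.

Lemma gram2_shear s t r y z :
  gram2 h (s *: y) (r *: y + t *: z) = (s * t) ^+ 2 * gram2 h y z.
Proof.
rewrite /gram2 !(symm_bilinearDr _ _ _ sh) !(symm_bilinearDl _ _ _ sh).
rewrite !symm_bilinearZZ (sh.2 z y); ring.
Qed.

Lemma form_poly a b x y : exists f : {poly R},
  forall s, f.[s] = h (s *: a + x) (s *: b + y).
Proof.
exists ((h a b)%:P * 'X^2 + (h a y + h x b)%:P * 'X + (h x y)%:P) => s.
rewrite !(hornerD, hornerM, hornerXn, hornerX, hornerC).
by rewrite sh.1 !(symm_bilinearPr _ _ _ _ sh); ring.
Qed.

End Gram.

(** * Model spaces with an algebraic curvature tensor *)

Section Model.
Variables (R : realType) (p q : nat) (V : model_space R (p + q)).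
Let n := (p + q)%N.
Let G := gram_mx V.
Let g := ip V.
Let F := curv V.
Hypothesis sigG : has_signature G.
Hypothesis cF : curvature_tensor F.
Implicit Types (x y z a b : 'rV[R]_n).

Let uG : G \in unitmx. Proof. exact: has_signature_unit. Qed.
Let GT : G^T = G. Proof. exact: has_signature_tr. Qed.

Lemma ip_symm_bilinear : symm_bilinear g.
Proof.
split=> [t x y z|x y]; rewrite /g /ip.
  by rewrite !mulmxDl -!scalemxAl !mxE.
have -> : y *m gram_mx V *m x^T = (x *m G *m y^T)^T.
  by rewrite !trmx_mul trmxK GT mulmxA.
by rewrite [RHS]mxE.
Qed.

(** Lets the hypotheses on spacelike planes be applied to pairs of vectors. *)
Lemma orthonormal_pair_basis y z : g y y = 1 -> g z z = 1 -> g y z = 0 ->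
  spacelike V <<[:: y; z]>> /\ orthonormal_basis V <<[:: y; z]>> [tuple y; z].
Proof.
move=> gy gz gyz; have [gP gC] := ip_symm_bilinear.
have gPr := symm_bilinearPr _ _ _ _ ip_symm_bilinear.
have g0 t : g t 0 = 0.
  by have := gPr 1 t 0 0; rewrite scale1r addr0 -/g; lra.
have gE s t : g (s *: y + t *: z) (s *: y + t *: z) = s ^+ 2 + t ^+ 2.
  rewrite -[X in g X _]addr0 -[X in g _ X]addr0 -!addrA !gP !gPr !g0.
  by rewrite !(gC 0) !g0 (gC z y) gy gz gyz; ring.
split.
  move=> x; rewrite span_cons span_seq1 => /memv_addP[_ /vlineP[s ->]].
  move=> [_ /vlineP[t ->]] -> nz; rewrite -/g gE.
  have [s0|s0] := eqVneq s 0; last first.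
    by rewrite ltr_pwDl ?sqr_ge0// exprn_even_gt0.
  rewrite s0 expr0n add0r exprn_even_gt0//=.
  by apply: contraNneq nz => t0; rewrite s0 t0 !scale0r addr0.
have z0 : z != 0.
  by apply/eqP => z0; move: gz; rewrite z0 g0 => /eqP; rewrite eq_sym oner_eq0.
split.
- rewrite /basis_of eqxx /= free_cons seq1_free z0 andbT span_seq1.
  apply/vlineP => -[t yE]; move: gy; rewrite {1}yE -[t *: z]addr0 gP gC gyz.
  by rewrite gC g0 mulr0 addr0 => /eqP; rewrite eq_sym oner_eq0.
- by move=> [[|[|//]] ?]; rewrite !(tnth_nth 0) /= -/g ?gy ?gz normr1.
move=> [[|[|//]] ?] [[|[|//]] ?]; rewrite -val_eqE//= => _;
  by rewrite !(tnth_nth 0) /= -/g ?gyz// gC.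
Qed.

Let S x y : 'M[R]_n := \matrix_(k, l) F x y (delta_mx 0 k) (delta_mx 0 l).

Lemma bilinear_mxE (h : 'rV[R]_n -> 'rV[R]_n -> R) :
  (forall t x y z, h (t *: x + y) z = t * h x z + h y z) ->
  (forall t x y z, h z (t *: x + y) = t * h z x + h z y) ->
  forall a b, h a b =
    (a *m (\matrix_(k, l) h (delta_mx 0 k) (delta_mx 0 l)) *m b^T) 0 0.
Proof.
move=> hl hr a b.
have h0l z : h 0 z = 0 by have := hl 1 0 0 z; rewrite scale1r addr0; lra.
have h0r z : h z 0 = 0 by have := hr 1 0 0 z; rewrite scale1r addr0; lra.
have suml I (r : seq I) c (v : I -> 'rV[R]_n) z :
    h (\sum_(i <- r) c i *: v i) z = \sum_(i <- r) c i * h (v i) z.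
  by elim: r => [|i r IH]; rewrite ?big_nil// !big_cons hl IH.
have sumr I (r : seq I) c (v : I -> 'rV[R]_n) z :
    h z (\sum_(i <- r) c i *: v i) = \sum_(i <- r) c i * h z (v i).
  by elim: r => [|i r IH]; rewrite ?big_nil// !big_cons hr IH.
rewrite {1}(row_sum_delta a) {1}(row_sum_delta b) sumr mxE.
apply: eq_bigr => j _; rewrite suml !mxE mulrC; congr (_ * _).
by apply: eq_bigr => i _; rewrite mxE.
Qed.

Lemma curv_mxE x y a b : F x y a b = (a *m S x y *m b^T) 0 0.
Proof.
apply: (bilinear_mxE (h := F x y)) => *; [exact: curvP3|exact: curvP4].
Qed.

Lemma curv_opE x y : curv_op V x y = S x y *m invmx G. Proof. by []. Qed.

Lemma ip_row k (E : 'M[R]_(k, n)) i j :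
  g (row i E) (row j E) = (E *m G *m E^T) i j.
Proof. exact: row_form_mx. Qed.

Lemma has_signature_spacelike_triple : (3 <= q)%N -> exists e1 e2 e3,
  [/\ g e1 e1 = 1, g e2 e2 = 1 & g e3 e3 = 1] /\
  [/\ g e1 e2 = 0, g e1 e3 = 0 & g e2 e3 = 0].
Proof.
move=> q3; case: sigG => B _ BE.
have q1 : (1 < q)%N by exact: leq_trans q3.
have q0 : (0 < q)%N by exact: leq_trans q3.
have gE (i j : 'I_q) :
    g (row (rshift p i) B) (row (rshift p j) B) = (i == j)%:R.
  by rewrite ip_row BE block_mxEdr mxE.
exists (row (rshift p (Ordinal q0)) B), (row (rshift p (Ordinal q1)) B).
by exists (row (rshift p (Ordinal q3)) B); rewrite !gE.
Qed.

Lemma gram_schmidt_pair y z : spacelike_pair g y z -> exists s t r,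
  [/\ s * t != 0, g (s *: y) (s *: y) = 1,
      g (r *: y + t *: z) (r *: y + t *: z) = 1 &
      g (s *: y) (r *: y + t *: z) = 0].
Proof.
move=> [gy gyz]; have [gP gC] := ip_symm_bilinear.
have gPr := symm_bilinearPr _ _ _ _ ip_symm_bilinear.
have gZ t x w : g (t *: x) w = t * g x w.
  have g0 : g 0 w = 0 by have := gP 1 0 0 w; rewrite scale1r addr0 -/g; lra.
  by rewrite -[t *: x]addr0 gP g0 addr0.
have gZr t x w : g w (t *: x) = t * g w x by rewrite gC gZ gC.
set D := gram2 g y z in gyz.
(* [a] is the length of [y] and [d] that of the component of [z] orthogonal to [y]. *)
pose a := Num.sqrt (g y y); pose d := Num.sqrt (D / g y y).
have a2 : a ^+ 2 = g y y by rewrite sqr_sqrtr// ltW.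
have d2 : d ^+ 2 = D / g y y by rewrite sqr_sqrtr// ltW// divr_gt0.
have a0 : a != 0 by rewrite gt_eqF// sqrtr_gt0.
have d0 : d != 0 by rewrite gt_eqF// sqrtr_gt0 divr_gt0.
have gy0 : g y y != 0 by rewrite gt_eqF.
exists a^-1, d^-1, (- (d^-1 * (g y z / g y y))); split.
- by rewrite mulf_neq0// invr_eq0.
- by rewrite gZ gZr -a2; field.
- rewrite !gP !gPr !gZ !gZr (gC z y).
  transitivity (D / g y y / d ^+ 2); last by rewrite -d2 divff// expf_neq0.
  by rewrite /D /gram2; field; rewrite gy0 d0.
- by rewrite !gZ !gPr !gZr; field; rewrite gy0 d0 a0.
Qed.

(** * Consequences of the Jordan condition in rank 2 *)

Section JordanIP.
Hypothesis q3 : (3 <= q)%N.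
Hypothesis IP : spacelike_jordan_IP V.
Hypothesis rank2 : constant_spacelike_rank V 2.

Let orthonormal_pair y z := [/\ g y y = 1, g z z = 1 & g y z = 0].

Lemma orthonormal_pair_rank y z : orthonormal_pair y z -> \rank (S y z) = 2%N.
Proof.
case=> gy gz gyz; have [sW oW] := orthonormal_pair_basis gy gz gyz.
have := rank2 sW oW; rewrite /skew_curv_op !(tnth_nth 0) /= curv_opE.
by rewrite mxrankMfree// row_free_unit unitmx_inv.
Qed.

Lemma orthonormal_pair_jordan y z y' z' : orthonormal_pair y z ->
  orthonormal_pair y' z' -> jordan_equivalent (curv_op V y z) (curv_op V y' z').
Proof.
move=> [gy gz gyz] [gy' gz' gyz'].
have [sW oW] := orthonormal_pair_basis gy gz gyz.
have [sW' oW'] := orthonormal_pair_basis gy' gz' gyz'.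
by have := IP sW sW' oW oW'; rewrite /skew_curv_op !(tnth_nth 0).
Qed.

Lemma spacelike_pair_curv y z : spacelike_pair g y z ->
  exists s (e f : 'rV[R]_n), [/\ s != 0, orthonormal_pair e f
    & forall a b, F y z a b = s * F e f a b].
Proof.
move=> /gram_schmidt_pair[s [t [r [st gy gz gyz]]]].
exists (s * t)^-1, (s *: y), (r *: y + t *: z).
split; [by rewrite invr_eq0|by split|move=> a b].
apply: (mulfI st); rewrite mulrA divff// mul1r.
by rewrite (curv_shear cF).
Qed.

Lemma spacelike_pair_rank2 y z : spacelike_pair g y z ->
  exists f h k l : 'rV[R]_n -> R, forall a b, F y z a b = f a * h b + k a * l b.
Proof.
move=> /spacelike_pair_curv[s [e [f [_ /orthonormal_pair_rank rk FE]]]].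
have := mulmx_base (S e f); move: (col_base _) (row_base _).
rewrite rk => C D SE.
exists (fun a => s * (a *m C) 0 0), (fun b => (D *m b^T) 0 0).
exists (fun a => s * (a *m C) 0 1), (fun b => (D *m b^T) 1 0) => a b.
rewrite FE curv_mxE -SE mulmxA -mulmxA mxE big_ord_recl big_ord1.
have -> : lift ord0 ord0 = 1 :> 'I_2 by apply: val_inj.
by rewrite mulrDr !mulrA.
Qed.

Lemma spacelike_pair_curv_neq0 y z : spacelike_pair g y z ->
  exists a b, F y z a b != 0.
Proof.
move=> /spacelike_pair_curv[s [e [f [s0 /orthonormal_pair_rank rk FE]]]].
apply: contrapT => nF; suff S0 : S e f = 0 by rewrite S0 mxrank0 in rk.
apply/matrixP => i j; rewrite !mxE; apply: contrapT => /eqP Fij.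
apply: nF; exists (delta_mx 0 i), (delta_mx 0 j).
by rewrite FE mulf_neq0.
Qed.

Lemma curv_gauss_mx : exists c (H : 'M[R]_n), [/\ c != 0, H^T = H &
  forall y z, S y z =
    c *: ((y *m H)^T *m (z *m H) - (z *m H)^T *m (y *m H))].
Proof.
have [e1 [e2 [e3 [[g11 g22 g33] [g12 g13 g23]]]]] :=
  has_signature_spacelike_triple q3.
have [c [h [c0 [hP hC] FE]]] := constant_rank2_gauss ip_symm_bilinear g11 g22
  g33 g12 g13 g23 cF spacelike_pair_rank2 spacelike_pair_curv_neq0.
have hPr := symm_bilinearPr _ _ _ _ (conj hP hC).
pose H : 'M[R]_n := \matrix_(k, l) h (delta_mx 0 k) (delta_mx 0 l).
have hE a b : h a b = (a *m H *m b^T) 0 0 by exact: bilinear_mxE.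
have hd y k : (y *m H) 0 k = h y (delta_mx 0 k).
  by rewrite hE trmx_delta -colE [RHS]mxE.
exists c, H; split=> //; first by apply/matrixP => i j; rewrite !mxE hC.
move=> y z; apply/matrixP => i j; rewrite mxE FE [RHS]mxE; congr (_ * _).
rewrite [RHS]mxE [X in _ = _ + X]mxE.
have dyad (u v : 'rV[R]_n) : (u^T *m v) i j = u 0 i * v 0 j.
  by rewrite mxE big_ord1 mxE.
by rewrite !dyad !hd (mulrC (h z _)).
Qed.

(** The trace of the squared operator fixes the Gram determinant of [L] on orthonormal pairs.
    Density and polarization turn this into an identity of curvature tensors, from which
    proportionality of [L] and [g] is read off in a basis when [del] is nonzero; [del = 0] uses rank
    and nilpotency. *)
Lemma gauss_sqr_conformal : exists c (H : 'M[R]_n) lam, [/\ H^T = H,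
  forall y z, curv_op V y z = gauss_op G H c y z & gauss_sqr G H = lam *: G].
Proof.
have [c [H [c0 HT SE]]] := curv_gauss_mx; exists c, H.
have opE y z : curv_op V y z = gauss_op G H c y z.
  by rewrite curv_opE SE /gauss_op -scalemxAl mulmxBl !mulmxA.
suff [lam lamE] : exists lam, gauss_sqr G H = lam *: G by exists lam.
have sL : symm_bilinear (gauss_form G H) by exact: gauss_form_symm_bilinear.
set L := gauss_form G H in sL.
have sg := ip_symm_bilinear.
have [e1 [e2 [e3 [[g11 g22 g33] [g12 g13 g23]]]]] :=
  has_signature_spacelike_triple q3.
pose del := gram2 L e1 e2.
have gramON y z : orthonormal_pair y z -> gram2 L y z = del.
  move=> yz; have e12 : orthonormal_pair e1 e2 by [].
  have /jordan_equivalent_sqr/jordan_equivalent_tr :=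
    orthonormal_pair_jordan yz e12.
  rewrite !opE !mxtrace_gauss_op_sqr// => /oppr_inj.
  by apply: mulfI; rewrite mulf_neq0 ?pnatr_eq0// expf_neq0.
(* Gram-Schmidt scales both determinants by the same square, so the equality passes to spacelike
   pairs and by density to all pairs. *)
have gramE y z : gram2 L y z = del * gram2 g y z.
  have [f1 f1E] := form_poly sL e1 e1 y y.
  have [f2 f2E] := form_poly sL e2 e2 z z.
  have [f3 f3E] := form_poly sL e1 e2 y z.
  have [k1 k1E] := form_poly sg e1 e1 y y.
  have [k2 k2E] := form_poly sg e2 e2 z z.
  have [k3 k3E] := form_poly sg e1 e2 y z.
  pose f := f1 * f2 - f3 * f3 - del%:P * (k1 * k2 - k3 * k3).
  have fE s : f.[s] = gram2 L (s *: e1 + y) (s *: e2 + z) -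
      del * gram2 g (s *: e1 + y) (s *: e2 + z).
    rewrite /f !(hornerD, hornerN, hornerM, hornerC) f1E f2E f3E k1E k2E k3E.
    by rewrite /gram2 !expr2.
  have := @horner0_eq0_of_spacelike _ _ g sg e1 e2 y z f g11 g22 g12.
  rewrite fE !scale0r !add0r => f0.
  apply/eqP; rewrite -subr_eq0; apply/eqP; apply: f0 => s.
  move: (s *: e1 + y) (s *: e2 + z) (fE s) => y' z' -> yz.
  have [s' [t [r [st gy gz gyz]]]] := gram_schmidt_pair yz.
  have := gramON (s' *: y') (r *: y' + t *: z') ltac:(by split).
  have : gram2 g (s' *: y') (r *: y' + t *: z') = 1.
    by rewrite /gram2 gy gz gyz expr0n subr0 mulr1.
  rewrite !gram2_shear// => e1' <-.
  by rewrite mulrAC e1' mul1r subrr.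
(* [gramE] says that the sectional values of this curvature tensor vanish; [sectional_eq0] then
   makes it zero. *)
pose T y z a b := L y a * L z b - L y b * L z a -
  del * (g y a * g z b - g y b * g z a).
have [gP gC] := sg; have [LP LC] := sL.
have cT : curvature_tensor T.
  split; rewrite /T.
  - by move=> t x y z a b; rewrite !gP !LP; ring.
  - by move=> x y a b; ring.
  - by move=> x y a b; rewrite !(gC a) !(gC b) !(LC a) !(LC b); ring.
  - move=> x y z w; rewrite (gC y x) (gC z x) (gC z y).
    by rewrite (LC y x) (LC z x) (LC z y); ring.
have TE y z a b : L y a * L z b - L y b * L z a =
    del * (g y a * g z b - g y b * g z a).
  apply/eqP; rewrite -subr_eq0; apply/eqP; rewrite -/(T y z a b).
  apply: sectional_eq0 => // {}y {}z; have := gramE y z.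
  by rewrite /T /gram2 (gC z y) (LC z y) => e; move: e; rewrite !expr2; lra.
have [del0|del0] := eqVneq del 0.
  exists 0; rewrite scale0r.
  (* If [L w w] is nonzero, [L] vanishes on the kernel of [L w], which contains an orthonormal
     spacelike pair with zero squared operator. The Jordan condition spreads this to all such pairs,
     rank 2 makes [L] vanish on spacelike vectors, and density gives [L w w = 0]. *)
  have L0 : forall y z, L y z = 0.
    apply: symm_bilinear_eq0 => // w; apply: contrapT => /eqP Lw.
    have Lker y z : L w y = 0 -> L w z = 0 -> L y z = 0.
      move=> wy wz; apply: (mulfI Lw); have := TE w y w z.
      by rewrite del0 mul0r wz (LC y w) wy mul0r subr0 mulr0 => ->.
    have [|y [z [wy wz yz]]] := spacelike_pair_in_kernel sg g11 g22 g33 g12 g13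
      g23 (u := fun y => L w y).
      by move=> t y z; rewrite (symm_bilinearPr _ _ _ _ sL).
    have [s [t [r [st gy gz gyz]]]] := gram_schmidt_pair yz.
    have LZ k x : L w x = 0 -> L w (k *: x) = 0.
      have := symm_bilinearZZ sL 1 k w x; rewrite scale1r => -> ->.
      by rewrite mulr0.
    have wey := LZ s y wy.
    have wez : L w (r *: y + t *: z) = 0.
      by rewrite (symm_bilinearPr _ _ _ _ sL) wy LZ// mulr0 addr0.
    have op0 := gauss_op_sqr_isotropic c (has_signature_tr sigG) HT
      (Lker _ _ wey wey) (Lker _ _ wez wez) (Lker _ _ wey wez).
    have LON e f : orthonormal_pair e f -> L e e = 0.
      move=> ef; apply: (gauss_op_sqr_eq0 (c := c) HT (z := f)).
        rewrite -opE curv_opE mxrankMfree ?orthonormal_pair_rank//.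
        by rewrite row_free_unit unitmx_inv.
      rewrite -opE; apply: jordan_equivalent0; rewrite -op0 -opE.
      apply: jordan_equivalent_sqr; apply: orthonormal_pair_jordan => //.
    have [f fE] := form_poly sL e1 e1 w w.
    (* Only the first vector of the pair enters the polynomial; 0 fills the second slot. *)
    have := @horner0_eq0_of_spacelike _ _ g sg e1 e2 w 0 f g11 g22 g12.
    rewrite fE scale0r add0r => f0; move/eqP: Lw; apply; apply: f0 => k.
    rewrite fE; move: (k *: e1 + w) (k *: e2 + 0) => y' z' yz'.
    have [s' [t' [r' [st' gy' gz' gyz']]]] := gram_schmidt_pair yz'.
    have := LON (s' *: y') (r' *: y' + t' *: z') ltac:(by split).
    rewrite symm_bilinearZZ// => /eqP; rewrite mulf_eq0 => /orP[|/eqP//].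
    move: st'; rewrite mulf_eq0 negb_or => /andP[/negPf s'0 _].
    by rewrite mulf_eq0 s'0.
  apply/matrixP => i j; rewrite [RHS]mxE -(L0 (delta_mx 0 i) (delta_mx 0 j)).
  by rewrite /L /gauss_form trmx_delta -rowE -colE !mxE.
case: sigG => B uB BE.
pose b i := row i B; pose eps i := @signature_mx R p q i i.
have gb i : g (b i) (b i) = eps i by rewrite ip_row BE.
have gb0 i j : i != j -> g (b i) (b j) = 0.
  by move=> ij; rewrite ip_row BE; exact: signature_mx_off.
have eps2 i : eps i * eps i = 1 by exact: signature_mx_diag.
have third (i j : 'I_n) : exists k, (k != i) && (k != j).
  apply/existsP; apply: contraT => /existsPn nk.
  have : (#|'I_n| <= #|pred2 i j|)%N.
    apply: subset_leq_card; apply/fintype.subsetP => k _.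
    by have := nk k; rewrite negb_and !negbK.
  rewrite card_ord card2 => le3.
  have : (n <= 2)%N by apply: leq_trans le3 _; case: eqP.
  by rewrite leqNgt (leq_trans q3)// leq_addl.
have Lii i j : i != j -> L (b i) (b i) * L (b j) (b j) -
    L (b i) (b j) * L (b i) (b j) = del * (eps i * eps j).
  move=> ij; have := TE (b i) (b j) (b i) (b j).
  by rewrite !gb (LC (b j)) gb0// mul0r subr0.
(* With a third index [k], the identity [TE] gives two linear equations in [L (b i) (b j)] and
   [L (b k) (b j)] whose determinant is the nonzero minor [nz]. *)
have Lij i j : i != j -> L (b i) (b j) = 0.
  move=> ij; have [k /andP[ki kj]] := third i j.
  have ik : i != k by rewrite eq_sym.
  have nz : L (b i) (b i) * L (b k) (b k) - L (b i) (b k) * L (b i) (b k) != 0.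
    rewrite Lii// mulf_neq0//; apply/eqP => e0.
    have := congr1 ( *%R (eps i * eps k)) e0; rewrite mulr0 mulrACA !eps2.
    by rewrite mulr1 => /eqP; rewrite oner_eq0.
  apply: (mulfI nz); rewrite mulr0.
  have := TE (b i) (b k) (b i) (b j); have := TE (b i) (b k) (b k) (b j).
  rewrite (gb0 i j)// (gb0 k j)// (gb0 i k)// (LC (b k) (b i)).
  rewrite !(mulr0, mul0r) subr0 mulr0 => h1 h2.
  have := congr1 ( *%R (L (b i) (b k))) h2.
  have := congr1 ( *%R (L (b i) (b i))) h1.
  by rewrite !mulr0; lra.
(* The eigenvalues of [L] relative to [g]. Distinct indices have product [del], so cancelling a
   third eigenvalue makes any two equal. *)
pose l i := eps i * L (b i) (b i).
have lij i j : i != j -> l i * l j = del.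
  move=> ij; have := Lii i j ij; rewrite (Lij i j)// mul0r subr0 => e.
  by rewrite /l mulrACA e mulrCA mulrACA !eps2 !mulr1.
have n0 : (0 < n)%N by rewrite (leq_trans _ (leq_addl p q))// (leq_trans _ q3).
pose i0 := Ordinal n0; exists (l i0).
have lE i : l i = l i0.
  have [k /andP[ki ki0]] := third i i0.
  have lk0 : l k != 0.
    by apply: contra_neq del0 => lk; rewrite -(lij k i ki) lk mul0r.
  by apply: (mulfI lk0); rewrite !lij.
have LBE : B *m gauss_sqr G H *m B^T = l i0 *: (B *m G *m B^T).
  apply/matrixP => i j; rewrite [RHS]mxE -ip_row.
  rewrite -[LHS]row_form_mx -/(b i) -/(b j) -/(gauss_form G H _ _) -/L.
  have [<-|ij] := eqVneq i j; last by rewrite Lij// gb0// mulr0.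
  by rewrite gb -(lE i) /l mulrAC eps2 mul1r.
have uBT : B^T \in unitmx by rewrite unitmx_tr.
move/(congr1 (fun A => invmx B *m A *m invmx B^T)): LBE.
rewrite -scalemxAr -scalemxAl -!mulmxA !mulmxV// !mulmx1.
by rewrite !mulKmx// /gauss_sqr mulmxA.
Qed.

(** [orthonormal_basis] fixes only absolute values; the definite sign on [W] turns them into the
    common value [eps]. *)
Lemma orthonormal_frame k W (e : k.-tuple 'rV[R]_n) (eps : R) :
  eps * eps = 1 -> orthonormal_basis V W e ->
  (forall x, x \in W -> x != 0 -> 0 < eps * g x x) ->
  let E := \matrix_(i < k) tnth e i in E *m G *m E^T = eps%:M.
Proof.
move=> eps2 [bW n1 e0] We E; apply/matrixP => i j.
rewrite -ip_row !rowK [RHS]mxE.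
have [<-|ij] := eqVneq i j; last by rewrite mulr0n; exact: e0.
have ei0 : tnth e i != 0.
  apply/eqP => ei0; have := n1 i; rewrite -/g ei0 symm_bilinear0 ?normr0.
    by move/eqP; rewrite eq_sym oner_eq0.
  exact: ip_symm_bilinear.
have := We _ (basis_mem bW (mem_tnth i e)) ei0; have := n1 i.
rewrite -/g mulr1n; case: (ger0P (g (tnth e i) (tnth e i))) => _ n1' pos.
  by rewrite n1' mulr1 in pos *; nra.
have {}n1' : g (tnth e i) (tnth e i) = -1 by lra.
by rewrite n1' in pos *; nra.
Qed.

(** Each higher curvature operator is a scalar independent of the frame times a product [C *m B]
    with [B *m C = (lam * eps)%:M]. If this scalar matrix is zero both operators vanish; otherwise
    [similar_factored] applies. *)
Lemma jordan_stanilov_of_sign (causal : {vspace 'rV[R]_n} -> Prop) (eps : R) k :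
  eps * eps = 1 -> (forall W, causal W -> forall x, x \in W -> x != 0 ->
    0 < eps * g x x) -> jordan_stanilov V causal k.
Proof.
move=> eps2 sgn W1 W2 e1 e2 c1 c2 o1 o2.
have [c [H [lam [HT opE LE]]]] := gauss_sqr_conformal.
have GE1 := orthonormal_frame eps2 o1 (sgn _ c1).
have GE2 := orthonormal_frame eps2 o2 (sgn _ c2).
pose E (e : k.-tuple 'rV[R]_n) := \matrix_(i < k) tnth e i.
have LEE e : E e *m G *m (E e)^T = eps%:M ->
    E e *m gauss_sqr G H *m (E e)^T = (lam * eps)%:M.
  by move=> GE; rewrite LE -scalemxAr -scalemxAl GE scale_scalar_mx.
have thetaE e : E e *m G *m (E e)^T = eps%:M -> higher_curv_op V e =
    (2 * c ^+ 2 * (lam * eps) * (1 - k%:R)) *: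
      ((E e *m H)^T *m (E e *m H *m invmx G)).
  move=> /LEE EE; rewrite -(gauss_op_sum c (has_signature_tr sigG) HT EE).
  by apply: eq_bigr => i _; apply: eq_bigr => j _; rewrite !rowK !opE.
rewrite (thetaE _ GE1) (thetaE _ GE2).
have [l0|l0] := eqVneq (lam * eps) 0.
  rewrite l0 mulr0 mul0r !scale0r; exists 1%:M; first exact: unitmx1.
  by rewrite conjumx ?unitmx1// mulmx0 mul0mx.
apply: jordan_equivalentZ.
have BC e : E e *m G *m (E e)^T = eps%:M ->
    E e *m H *m invmx G *m (E e *m H)^T = (lam * eps)%:M.
  by move=> /LEE <-; rewrite trmx_mul HT /gauss_sqr !mulmxA.
exact: similar_factored l0 (BC _ GE1) (BC _ GE2).
Qed.

End JordanIP.

End Model.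

(** * Symmetries of the Riemann tensor *)

Section Schwarz.
Variables (R : realType) (V : normedModType R).
Implicit Types (f : V -> R) (x v w : V).

Lemma is_derive_line f v c (s : R) : derivable f (s *: v + c) v ->
  is_derive s (1 : R) (fun s => f (s *: v + c)) ('D_v f (s *: v + c)).
Proof.
have E : (fun h : R => h^-1 *: (((fun s => f (s *: v + c)) \o shift s) (h *: 1)
    - f (s *: v + c))) =
    (fun h : R => h^-1 *: ((f \o shift (s *: v + c)) (h *: v)
    - f (s *: v + c))).
  by apply/funext => h /=; rewrite [_%:A]mulr1 scalerDl addrA.
by move=> df; split; rewrite /derivable /derive E.
Qed.

(* Mean value theorem along v, then differentiability of 'D_v f at x. *)
Lemma second_difference f x v w :
  (\forall y \near x, derivable f y v) -> differentiable ('D_v f) x ->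
  forall e : R, 0 < e -> \forall t \near (0:R)^'+,
  `|f (t *: v + (t *: w + x)) - f (t *: v + x) - f (t *: w + x) + f x
    - t ^+ 2 * 'D_w ('D_v f) x| <= e * t ^+ 2.
Proof.
move=> df dg e e0; set g := 'D_v f in dg *.
(* The summand 1 keeps [N] positive when [v] and [w] vanish. The factor 2 in [eta] pays for the two
   linearization errors. *)
pose N := `|v| + `|w| + 1.
have N0 : 0 < N by rewrite /N ltr_wpDl// addr_ge0.
pose eta := e / (2 * N).
have eta0 : 0 < eta by rewrite /eta divr_gt0// mulr_gt0.
have /eqaddoP/(_ _ eta0) gE := diff_locally dg.
rewrite (near_shift 0 x) /= in df.
have /nbhs_ballP[d /= d0 dP] : \forall h \near (0:V), derivable f (h + x) v /\
    `|g (h + x) - g x - 'd g x h| <= eta * `|h|.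
  near=> h; split; last first.
    by near: h; move: gE; apply: filterS => h /=; rewrite opprD addrA.
  by near: h; move: df; apply: filterS => h /=; rewrite subr0.
rewrite deriveE//.
near=> t.
have t0 : 0 < t by near: t; exact: nbhs_right_gt.
have tN : t * N < d.
  rewrite -ltr_pdivlMr//; near: t; apply: nbhs_right_lt.
  by rewrite divr_gt0.
have {}dP s r : 0 <= s <= t -> 0 <= r <= t ->
    derivable f (s *: v + (r *: w + x)) v /\
    `|g (s *: v + (r *: w + x)) - g x - 'd g x (s *: v + r *: w)|
       <= eta * (t * (`|v| + `|w|)).
  move=> /andP[s0 st] /andP[r0 rt].
  have le : `|s *: v + r *: w| <= t * (`|v| + `|w|).
    rewrite (le_trans (ler_normD _ _))// !normrZ mulrDr !ger0_norm//.
    by rewrite lerD// ler_wpM2r.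
  have [] := dP (s *: v + r *: w).
    rewrite -ball_normE /= sub0r normrN (le_lt_trans le)// (le_lt_trans _ tN)//.
    by rewrite ler_pM2l// /N lerDl.
  rewrite -addrA => ? h; split=> //; rewrite (le_trans h)//.
  by rewrite ler_pM2l.
(* The second difference is [phi t - phi 0]. *)
pose phi s := f (s *: v + (t *: w + x)) - f (s *: v + x).
pose dphi s := g (s *: v + (t *: w + x)) - g (s *: v + x).
have phiD s : 0 <= s <= t -> is_derive s 1 phi (dphi s).
  move=> st; apply: is_deriveB.
    by apply: is_derive_line; apply: (dP _ _ st _).1; rewrite lexx ltW.
  apply: is_derive_line; have := (dP s 0 st _).1.
  by rewrite scale0r add0r; apply; rewrite lexx ltW.
have [] := @MVT R phi dphi 0 t t0.
- by move=> s; rewrite in_itv /= => /andP[? ?]; apply: phiD; rewrite !ltW.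
- apply: derivable_within_continuous => s; rewrite in_itv /= => st.
  by have [] := phiD s st.
move=> s; rewrite in_itv /= => /andP[s0 st] E.
have -> : f (t *: v + (t *: w + x)) - f (t *: v + x) - f (t *: w + x) + f x =
    dphi s * t.
  by rewrite -[t in RHS]subr0 -E /phi !scale0r !add0r; ring.
have st' : 0 <= s <= t by rewrite !ltW.
have [_ h1] := dP s t st' ltac:(by rewrite lexx ltW).
have [_ h2] := dP s 0 st' ltac:(by rewrite lexx ltW).
rewrite scale0r add0r addr0 in h2; rewrite linearD !linearZ /= in h1.
rewrite linearZ /= in h2.
have -> : dphi s * t - t ^+ 2 * 'd g x w = t * (
   (g (s *: v + (t *: w + x)) - g x - (s *: 'd g x v + t *: 'd g x w)) -
   (g (s *: v + x) - g x - s *: 'd g x v)).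
  have I (a b c D1 D2 r : R) : (a - b) * t - t ^+ 2 * D2 =
    t * ((a - c - (r * D1 + t * D2)) - (b - c - r * D1)) by ring.
  exact: I.
rewrite normrM (gtr0_norm t0) expr2 mulrCA ler_pM2l//.
rewrite (le_trans (ler_normB _ _))// (le_trans (lerD h1 h2))//.
have eE : e = eta * (2 * N) by rewrite /eta divfK// gt_eqF// mulr_gt0.
have I (a X : R) : 0 < a -> a * (t * X) + a * (t * X) <= a * (2 * (X + 1)) * t.
  by move=> a0; have := mulr_gt0 a0 t0; lra.
by rewrite [in leRHS]eE; exact: I.
Unshelve. all: by end_near. Qed.

(** The second difference is symmetric in [v] and [w], so both iterated derivatives are the limit of
    its quotient by [t ^+ 2]. *)
Lemma derive_commute f x v w :
  (\forall y \near x, derivable f y v) ->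
  (\forall y \near x, derivable f y w) ->
  differentiable ('D_v f) x -> differentiable ('D_w f) x ->
  'D_w ('D_v f) x = 'D_v ('D_w f) x.
Proof.
move=> dv dw ddv ddw; apply/eqP; rewrite -subr_eq0 -normr_le0.
apply/ler_addgt0Pr => e e0; rewrite add0r.
have e20 : 0 < e / 2 by rewrite divr_gt0.
have [t [[t0 h1] h2]] := filter_ex (filterI (filterI (nbhs_right_gt (0 : R))
  (second_difference w dv ddv e20)) (second_difference v dw ddw e20)).
have t20 : 0 < t ^+ 2 by rewrite exprn_gt0.
move: h1 h2; rewrite (addrCA (t *: w)) => h1 h2.
have I (a b c d p q : R) : `|a - b - c + d - t ^+ 2 * p| <= e / 2 * t ^+ 2 ->
    `|a - c - b + d - t ^+ 2 * q| <= e / 2 * t ^+ 2 -> `|p - q| <= e.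
  move=> {}h1 {}h2; rewrite -(ler_pM2l t20) -[X in X * `|_|]gtr0_norm// -normrM.
  move: h1 h2; rewrite !ler_norml => /andP[? ?] /andP[? ?].
  by apply/andP; split; lra.
exact: I h1 h2.
Qed.

End Schwarz.

(** * Derivatives of determinants and inverse matrices *)

Section DerivableMatrix.
Variables (R : realType) (V : normedModType R).
Implicit Types (x v : V).

Lemma derivable_bigsum I (r : seq I) (P : pred I) (F : I -> V -> R) x v :
  (forall i, P i -> derivable (F i) x v) ->
  derivable (fun y => \sum_(i <- r | P i) F i y) x v.
Proof.
move=> dF; rewrite (_ : (fun y => _) = \sum_(i <- r | P i) F i); last first.
  by apply/funext => y; rewrite fct_sumE.
elim/big_rec: _ => [|i f Pi df]; first exact: derivable_cst.
exact: derivableD (dF i Pi) df.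
Qed.

Lemma derivable_bigprod I (r : seq I) (P : pred I) (F : I -> V -> R) x v :
  (forall i, P i -> derivable (F i) x v) ->
  derivable (fun y => \prod_(i <- r | P i) F i y) x v.
Proof.
move=> dF; rewrite (_ : (fun y => _) = \prod_(i <- r | P i) F i); last first.
  by apply/funext => y; rewrite fct_prodE.
elim/big_rec: _ => [|i f Pi df]; first exact: derivable_cst.
exact: derivableM (dF i Pi) df.
Qed.

Lemma derivable_det n (M : V -> 'M[R]_n) x v :
  (forall i j, derivable (fun y => M y i j) x v) ->
  derivable (fun y => \det (M y)) x v.
Proof.
move=> dM; apply: derivable_bigsum => s _.
apply: derivableM; first exact: derivable_cst.
exact: derivable_bigprod.
Qed.

Lemma derivable_invmx n (M : V -> 'M[R]_n) x v :
  (forall i j, derivable (fun y => M y i j) x v) ->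
  (\forall y \near x, M y \in unitmx) ->
  forall i j, derivable (fun y => invmx (M y) i j) x v.
Proof.
move=> dM uM i j.
apply: (@near_eq_derivable _ _ _
  ((fun y => (\det (M y))^-1) * (fun y => cofactor (M y) j i))).
  by near=> y; rewrite /invmx (near uM y)// !mxE.
have dx : \det (M x) != 0 by have := nbhs_singleton uM; rewrite unitmxE unitfE.
apply: derivableM; first by apply: derivableV => //; exact: derivable_det.
apply: derivableM; first exact: derivable_cst.
apply: derivable_det => k l.
by under eq_fun do rewrite !mxE; exact: dM.
Unshelve. all: by end_near. Qed.

End DerivableMatrix.

(** * Symmetries of the coordinate curvature tensor *)

Section RiemannSymmetries.
Variables (R : realType) (n : nat) (G : 'rV[R]_n -> 'M[R]_n) (U : set 'rV[R]_n).
Hypothesis oU : open U.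
Hypothesis smoothG : forall i j, smooth_on U (fun y => G y i j).
Hypothesis symG : forall y, U y -> (G y)^T = G y.
Hypothesis unitG : forall y, U y -> G y \in unitmx.
Implicit Types (x y : 'rV[R]_n) (i j k l s : 'I_n).

Let nearU x : U x -> \forall y \near x, U y.
Proof. by move=> Ux; apply: open_nbhs_nbhs; split. Qed.

Let symGE y i j : U y -> G y i j = G y j i.
Proof. by move=> Uy; rewrite -[in LHS](symG Uy) mxE. Qed.

Let pderiv_sym y i j k : U y ->
  pderiv i (fun y => G y j k) y = pderiv i (fun y => G y k j) y.
Proof.
move=> Uy; apply: near_eq_derive; near=> z; apply: symGE.
by near: z; exact: nearU.
Unshelve. all: by end_near. Qed.

(** Christoffel symbols of the first kind, with [l] the lowered index. *)
Definition christoffel_low j k l y : R :=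
  2^-1 * (pderiv j (fun y => G y k l) y + pderiv k (fun y => G y j l) y
     - pderiv l (fun y => G y j k) y).

Lemma christoffelE l j k y :
  christoffel G l j k y = \sum_s invmx (G y) l s * christoffel_low j k s y.
Proof.
rewrite /christoffel mulr_sumr; apply: eq_bigr => s _.
by rewrite mulrCA.
Qed.

Lemma christoffel_sym l j k y : U y ->
  christoffel G l j k y = christoffel G l k j y.
Proof.
move=> Uy; congr (_ * _); apply: eq_bigr => s _.
by rewrite (pderiv_sym s j k Uy) (addrC (pderiv j _ _)).
Qed.

Lemma christoffel_lower j k l y : U y ->
  \sum_s christoffel G s j k y * G y s l = christoffel_low j k l y.
Proof.
move=> Uy; under eq_bigr do rewrite christoffelE mulr_suml.
rewrite exchange_big /=.
transitivity (\sum_t (G y *m invmx (G y)) l t * christoffel_low j k t y).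
  apply: eq_bigr => t _; rewrite mxE mulr_suml; apply: eq_bigr => s _.
  by rewrite (symGE s l Uy); ring.
rewrite mulmxV ?unitG// (bigD1 l)//= mxE eqxx mul1r [X in _ + X]big1 ?addr0//.
by move=> t tl; rewrite mxE eq_sym (negPf tl) mul0r.
Qed.

Lemma christoffel_lowD j k l y : U y ->
  christoffel_low j k l y + christoffel_low j l k y =
  pderiv j (fun y => G y k l) y.
Proof.
move=> Uy; rewrite /christoffel_low (pderiv_sym j l k Uy).
by rewrite (pderiv_sym k j l Uy) (pderiv_sym l j k Uy); field.
Qed.

Let dG i j v y : U y -> derivable (fun y => G y i j) y v.
Proof.
by move=> Uy; apply: diff_derivable; exact: (smoothG i j [::] Uy).
Qed.

Let ddG k i j y : U y -> differentiable (pderiv k (fun y => G y i j)) y.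
Proof. by move=> Uy; exact: (smoothG i j [:: k] Uy). Qed.

Lemma derivable_christoffel_low j k l v y : U y ->
  derivable (christoffel_low j k l) y v.
Proof.
move=> Uy; apply: derivableM; first exact: derivable_cst.
apply: derivableB; first apply: derivableD;
  by apply: diff_derivable; exact: ddG.
Qed.

Lemma derivable_christoffel j k l v y : U y ->
  derivable (christoffel G l j k) y v.
Proof.
move=> Uy; rewrite (funext (christoffelE l j k)).
apply: derivable_bigsum => s _; apply: derivableM.
  apply: derivable_invmx => [i t|]; first exact: dG.
  by near=> z; apply: unitG; near: z; exact: nearU.
exact: derivable_christoffel_low.
Unshelve. all: by end_near. Qed.

Let U_eq_pderiv (f h : 'rV[R]_n -> R) i x : U x ->
  (forall y, U y -> f y = h y) -> pderiv i f x = pderiv i h x.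
Proof.
move=> Ux fh; apply: near_eq_derive; near=> z; apply: fh.
by near: z; exact: nearU.
Unshelve. all: by end_near. Qed.

Lemma riemannN i j k l x : riemann G i j k l x = - riemann G j i k l x.
Proof.
rewrite /riemann -sumrN; apply: eq_bigr => s _; rewrite -mulNr.
congr (_ * _); rewrite /riemann_up opprD opprB -sumrN.
by congr (_ + _); apply: eq_bigr => m _; rewrite opprB.
Qed.

(** The derivative terms and the quadratic terms cancel separately, by symmetry of the Christoffel
    symbols in their lower indices. *)
Lemma riemann_bianchi i j k l x : U x ->
  riemann G i j k l x + riemann G j k i l x + riemann G k i j l x = 0.
Proof.
move=> Ux; rewrite /riemann -!big_split big1//= => s _.
pose D a b c := pderiv a (christoffel G s b c) x.
pose S a b c := \sum_m christoffel G s a m x * christoffel G m b c x.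
have upE a b c :
    riemann_up G a b c s x = D a b c - D b a c + (S a b c - S b a c).
  by rewrite /S -sumrB.
have DC a b c : D a b c = D a c b.
  by apply: U_eq_pderiv => // y; exact: christoffel_sym.
have SC a b c : S a b c = S a c b.
  by apply: eq_bigr => m _; rewrite (christoffel_sym _ b).
clearbody D S.
rewrite !upE (DC i k j) (DC k j i) (DC j i k) (SC i k j) (SC j i k) (SC k j i).
ring.
Qed.

Lemma pderiv_metric i k l x : U x ->
  pderiv i (fun y => G y k l) x =
  christoffel_low i k l x + christoffel_low i l k x.
Proof. by move=> Ux; rewrite christoffel_lowD. Qed.

Lemma pderiv_christoffel_low i j k l x : U x ->
  pderiv i (christoffel_low j k l) x =
  \sum_s pderiv i (christoffel G s j k) x * G x s l +
  \sum_s christoffel G s j k x * pderiv i (fun y => G y s l) x.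
Proof.
move=> Ux.
rewrite -(U_eq_pderiv i Ux (fun y => @christoffel_lower j k l y)).
rewrite (_ : (fun y => \sum_s _) =
    \sum_s (christoffel G s j k * (fun y => G y s l))); last first.
  by apply/funext => y; rewrite fct_sumE.
rewrite /pderiv derive_sum => [|s].
  rewrite -big_split; apply: eq_bigr => s _ /=.
  rewrite deriveM; [|exact: derivable_christoffel|exact: dG].
  by rewrite addrC; congr (_ + _); rewrite mulrC.
by apply: derivableM; [exact: derivable_christoffel|exact: dG].
Qed.

(** Moving the metric under the derivative costs a derivative of the metric, which is a sum of two
    first kind symbols. One accounts for the quadratic term [Q], the other survives as [N]. *)
Lemma riemannE i j k l x : U x -> riemann G i j k l x =
  pderiv i (christoffel_low j k l) x - pderiv j (christoffel_low i k l) x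
  - \sum_s christoffel G s j k x * christoffel_low i l s x
  + \sum_s christoffel G s i k x * christoffel_low j l s x.
Proof.
move=> Ux.
pose D a b c := \sum_s pderiv a (christoffel G s b c) x * G x s l.
pose Q a b c := \sum_s
  (\sum_m christoffel G s a m x * christoffel G m b c x) * G x s l.
pose N a b c := \sum_s christoffel G s b c x * christoffel_low a l s x.
have QE a b c : Q a b c =
    \sum_s christoffel G s b c x * christoffel_low a s l x.
  rewrite /Q; under eq_bigr do rewrite mulr_suml.
  rewrite exchange_big; apply: eq_bigr => m _ /=.
  by rewrite -christoffel_lower// mulr_sumr; apply: eq_bigr => s _; ring.
have lowE a b c : pderiv a (christoffel_low b c l) x =
    D a b c + (Q a b c + N a b c).
  rewrite pderiv_christoffel_low//; congr (_ + _).
  rewrite QE -big_split; apply: eq_bigr => s _.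
  by rewrite pderiv_metric// mulrDr.
have RE a b c : riemann G a b c l x = D a b c - D b a c + (Q a b c - Q b a c).
  rewrite /D /Q -!sumrB -big_split; apply: eq_bigr => s _ /=.
  by rewrite /riemann_up sumrB mulrDl !mulrBl.
rewrite RE !lowE -/(N i j k) -/(N j i k).
clearbody D Q N; ring.
Qed.

(** Adding the version with [k] and [l] exchanged leaves a commutator of second derivatives of the
    metric, zero by [derive_commute], and quadratic terms that cancel by [NC]. *)
Lemma riemannNr i j k l x : U x -> riemann G i j k l x = - riemann G i j l k x.
Proof.
move=> Ux; apply/eqP; rewrite -addr_eq0; apply/eqP.
have low2 a b : pderiv a (christoffel_low b k l) x +
    pderiv a (christoffel_low b l k) x =
    pderiv a (pderiv b (fun y => G y k l)) x.
  rewrite -deriveD; try exact: derivable_christoffel_low.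
  by apply: U_eq_pderiv => // y; exact: christoffel_lowD.
have schwarz : pderiv i (pderiv j (fun y => G y k l)) x =
    pderiv j (pderiv i (fun y => G y k l)) x.
  by apply: derive_commute; [| |exact: ddG|exact: ddG];
    near=> z; apply: dG; near: z; exact: nearU.
pose N a b c d := \sum_s christoffel G s a b x * christoffel_low c d s x.
have NC a b c d : N a b c d = N c d a b.
  rewrite /N; under eq_bigr do rewrite christoffelE mulr_suml.
  rewrite exchange_big; apply: eq_bigr => s _ /=.
  rewrite christoffelE mulr_suml; apply: eq_bigr => t _.
  have -> : invmx (G x) s t = invmx (G x) t s.
    by rewrite -[in RHS](symG Ux) -trmx_inv mxE.
  ring.
pose P a b c d := pderiv a (christoffel_low b c d) x.
have RE a b c d : riemann G a b c d x =
    P a b c d - P b a c d - N b c a d + N a c b d by exact: riemannE.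
have := low2 i j; have := low2 j i; rewrite schwarz.
rewrite !RE (NC j k i l) (NC i k j l) -!/(P _ _ _ _).
move: (pderiv _ _ _); clearbody P N => p; clear schwarz; lra.
Unshelve. all: by end_near. Qed.

End RiemannSymmetries.

(** * From components to a multilinear curvature tensor *)

Section Tensors.
Variables (R : realType) (n : nat) (T : 'I_n -> 'I_n -> 'I_n -> 'I_n -> R).
Hypothesis TN : forall i j k l, T i j k l = - T j i k l.
Hypothesis TNr : forall i j k l, T i j k l = - T i j l k.
Hypothesis T_bianchi : forall i j k l, T i j k l + T j k i l + T k i j l = 0.

Lemma bianchi_pair_sym i j k l : T i j k l = T k l i j.
Proof.
have := T_bianchi i j k l; have := T_bianchi j k l i.
have := T_bianchi k l i j; have := T_bianchi l i j k.
have := TNr j k i l; have := TN k i j l; have := TNr i k j l.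
have := TNr k l j i; have := TN l j k i; have := TNr j l k i.
have := TNr l i k j; have := TNr i j l k; lra.
Qed.

(** Shaped like the [curv] field of [tangent_model], so that facts about it apply there by
    conversion. *)
Definition contract4 (x y z w : 'rV[R]_n) : R := \sum_i \sum_j \sum_k \sum_l
  x 0 i * y 0 j * z 0 k * w 0 l * T i j k l.

Let sum3_rot (f : 'I_n -> 'I_n -> 'I_n -> R) :
  \sum_i \sum_j \sum_k f i j k = \sum_k \sum_i \sum_j f i j k.
Proof. by under eq_bigr do rewrite exchange_big; rewrite exchange_big. Qed.

Lemma contract4_curvature : curvature_tensor contract4.
Proof.
rewrite /contract4; split.
- move=> t x y z a b; rewrite mulr_sumr -big_split; apply: eq_bigr => i _.
  rewrite mulr_sumr -big_split; apply: eq_bigr => j _.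
  rewrite mulr_sumr -big_split; apply: eq_bigr => k _.
  rewrite mulr_sumr -big_split; apply: eq_bigr => l _ /=.
  by rewrite !mxE; ring.
- move=> x y a b; rewrite exchange_big -sumrN; apply: eq_bigr => i _.
  rewrite -sumrN; apply: eq_bigr => j _; rewrite -sumrN; apply: eq_bigr => k _.
  by rewrite -sumrN; apply: eq_bigr => l _; rewrite TN; ring.
- move=> x y a b; rewrite sum3_rot; apply: eq_bigr => k _.
  rewrite sum3_rot; apply: eq_bigr => l _; apply: eq_bigr => i _.
  by apply: eq_bigr => j _; rewrite bianchi_pair_sym; ring.
- move=> x y z w.
  rewrite (sum3_rot (fun i j k =>
    \sum_l y 0 i * z 0 j * x 0 k * w 0 l * T i j k l)).
  rewrite -(sum3_rot (fun j k i =>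
    \sum_l z 0 i * x 0 j * y 0 k * w 0 l * T i j k l)).
  rewrite -!big_split big1// => i _; rewrite -!big_split big1// => j _.
  rewrite -!big_split big1// => k _; rewrite -!big_split big1// => l _ /=.
  have e := T_bianchi i j k l.
  transitivity (x 0 i * y 0 j * z 0 k * w 0 l *
    (T i j k l + T j k i l + T k i j l)); first by ring.
  by rewrite e mulr0.
Qed.

End Tensors.

Lemma tangent_model_curvature (R : realType) (p q : nat)
    (M : smooth_manifold R (p + q)) (g : pseudo_riemannian_metric M)
    (c : chart R M (p + q)) (P : M) : atlas c -> dom c P ->
  curvature_tensor (curv (tangent_model g c P)).
Proof.
move=> ac dP; pose U := Defs.coord c @` dom c.
have oU : open U by exact: codom_open.
have UP : U (Defs.coord c P) by exists P.
have smoothG i j : smooth_on U (fun y => g c y i j) by exact: metric_smooth.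
have symG y : U y -> (g c y)^T = g c y.
  by case=> Q dQ <-; apply: has_signature_tr; exact: metric_signature.
have unitG y : U y -> g c y \in unitmx.
  by case=> Q dQ <-; apply: has_signature_unit; exact: metric_signature.
apply: contract4_curvature => i j k l.
- exact: riemannN.
- exact: (riemannNr oU smoothG symG unitG).
- exact: (riemann_bianchi oU symG).
Qed.

Theorem theorem1p4 (R : realType) (p q : nat) (M : smooth_manifold R (p + q))
    (g : @pseudo_riemannian_metric R p q M)
    (M_connected : connected [set: M])
    (g_IP : at_every_point g (fun V => spacelike_jordan_IP V))
    (pq : (p = 0%N /\ q = 4%N) \/ (5 <= q)%N)
    (g_not_nilpotent : at_some_point g (fun V =>
       exists (W : {vspace 'rV[R]_(p + q)}) (e : 2.-tuple 'rV[R]_(p + q)),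
         [/\ spacelike V W, orthonormal_basis V W e
           & ~ nilpotent_mx (skew_curv_op V e)]))
    (g_rank : at_every_point g (fun V => constant_spacelike_rank V 2)) :
  (forall k : nat, (2 <= k <= q)%N ->
     at_every_point g (fun V => spacelike_jordan_stanilov V k)) /\
  (forall k : nat, (2 <= k <= p)%N ->
     at_every_point g (fun V => timelike_jordan_stanilov V k)).
Proof.
have q3 : (3 <= q)%N by case: pq => [[_ ->]//|]; exact: leq_trans.
(* The sign [eps] treats the spacelike and timelike conclusions together. *)
have stanilov (causal : forall V : model_space R (p + q),
    {vspace 'rV[R]_(p + q)} -> Prop) (eps : R) k : eps * eps = 1 ->
    (forall V W, causal V W -> forall x, x \in W -> x != 0 ->
      0 < eps * ip V x x) ->
    at_every_point g (fun V => jordan_stanilov V (causal V) k).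
  move=> eps2 sgn P c ac dP.
  have := @jordan_stanilov_of_sign R p q (tangent_model g c P)
    (metric_signature g ac dP)
    (tangent_model_curvature g ac dP) q3 (g_IP P c ac dP) (g_rank P c ac dP).
  by move=> /(_ (causal _) eps k eps2 (sgn _)).
split=> k _.
- apply: (stanilov (@spacelike R (p + q)) 1); first by rewrite mulr1.
  by move=> V W sW x xW x0; rewrite mul1r; exact: sW.
- apply: (stanilov (@timelike R (p + q)) (-1)); first by rewrite mulrNN mulr1.
  by move=> V W tW x xW x0; rewrite mulN1r oppr_gt0; exact: tW.
Qed.
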